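(* Let $\mathbb T^2=\mathbb R^2/\mathbb Z^2$ be the $2$-torus with its normalized Haar measure $\nu$ and let $G=\mathrm{Aut}(\mathbb T^2)\simeq GL(2,\mathbb Z)$ be its automorphism group. Let $\Gamma<G$ be a free subgroup of rank $r\geq 1$ freely generated by $\{a_1,\dots,a_r\}\subset G$. Let $S=\{a_1^{\pm 1},\dots,a_r^{\pm 1}\}$ and let $q=2r-1$. For every integer $n\ge 0$, let $S_n$, respectively $B_n$, be the sphere, respectively the ball, of $\Gamma$ around the identity $e\in\Gamma$ of radius $n$ with respect to the word metric defined by $S$. Then \[ \sup_{\|f\|_2=1}\left\|x\mapsto\frac{1}{|S_n|}\sum_{\gamma\in S_n}f(\gamma x)-\int_{\mathbb T^2}f(y)\,d\nu(y)\right\|_2=\left(1+\frac{q-1}{q+1}n\right)q^{-n/2}, \] and \[ \sup_{\|f\|_2=1}\left\|x\mapsto\frac{1}{|B_n|}\sum_{\gamma\in B_n}f(\gamma x)-\int_{\mathbb T^2}f(y)\,d\nu(y)\right\|_2= c(q,n)\left(1+\left(1+\frac{1}{\sqrt q}\right)n\right)q^{-n/2}, \] where $c(q,n)=\left(1+2q^{-n}\sum_{k=0}^{n-1}q^k\right)^{-1}$. In both formulas the supremum is over all $f\in L^2(\mathbb T^2,\nu)$ (complex-valued) with $\|f\|_2=1$.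
   Context: $GL(2,\mathbb Z)$ acts on $\mathbb T^2=\mathbb R^2/\mathbb Z^2$ by the automorphisms induced by its linear action on $\mathbb R^2$. The word length of $\gamma\in\Gamma$ is the smallest $k$ such that $\gamma$ is a product of $k$ elements of $S$; $S_n$ is the set of elements of word length exactly $n$, and $B_n$ the set of elements of word length at most $n$. $\|\cdot\|_2$ is the $L^2(\mathbb T^2,\nu)$-norm. For $n=0$ the empty sum $\sum_{k=0}^{n-1}q^k$ equals $0$. *)

(* Defs.v *)
From HB Require Import structures.
From mathcomp Require Import all_boot all_order all_algebra archimedean.
From mathcomp Require Import finmap.
From mathcomp Require Import all_classical all_reals all_analysis.
From mathcomp Require Import complex.

Set Implicit Arguments.
Unset Strict Implicit.
Unset Printing Implicit Defensive.

Import Order.TTheory GRing.Theory Num.Theory.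
Import numFieldNormedType.Exports.

Local Open Scope classical_set_scope.
Local Open Scope ring_scope.

Section WordMetric.
Variable G : groupType.
Local Open Scope group_scope.

Definition is_subgroup (H : set G) : Prop :=
  H 1 /\ forall x y, H x -> H y -> H (x * y^-1).

Definition generated_subgroup (A : set G) : set G := smallest is_subgroup A.

(* The letter (i, false) stands for a_i and (i, true) for its inverse. *)
Definition letter r (a : 'I_r -> G) (l : 'I_r * bool) : G :=
  if l.2 then (a l.1)^-1 else a l.1.

Definition reduced r (w : seq ('I_r * bool)) : bool :=
  sorted (fun l m => ~~ ((l.1 == m.1) && (l.2 != m.2))) w.

Definition freely_generated r (Gamma : set G) (a : 'I_r -> G) : Prop :=
  Gamma = generated_subgroup (range a) /\
  forall w, reduced w -> w <> [::] -> \prod_(l <- w) letter a l <> 1.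

Definition symmetric_generators r (a : 'I_r -> G) : set G :=
  range a `|` range (fun i => (a i)^-1).

Definition is_product (S : set G) (k : nat) (g : G) : Prop :=
  exists w : k.-tuple G,
    (forall i, S (tnth w i)) /\ g = \prod_(i < k) tnth w i.

Definition has_word_length (S : set G) (g : G) (k : nat) : Prop :=
  is_product S k g /\ forall j, is_product S j g -> (k <= j)%N.

Definition sphere (Gamma S : set G) (n : nat) : set G :=
  [set g | Gamma g /\ has_word_length S g n].

Definition word_ball (Gamma S : set G) (n : nat) : set G :=
  [set g | Gamma g /\ exists2 k, (k <= n)%N & has_word_length S g k].

End WordMetric.

Definition GL2Z : Type := {A : 'M[int]_2 | A \in unitmx}.
HB.instance Definition _ := Choice.on GL2Z.

Definition GL2Z_mx (g : GL2Z) : 'M[int]_2 := val g.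

Section GL2ZGroup.
Implicit Types g h : GL2Z.

Fact GL2Z_one_subproof : (1%:M : 'M[int]_2) \in unitmx.
Proof. exact: unitmx1. Qed.

Fact GL2Z_mul_subproof g h : GL2Z_mx g *m GL2Z_mx h \in unitmx.
Proof. by rewrite unitmx_mul (valP g) (valP h). Qed.

Fact GL2Z_inv_subproof g : invmx (GL2Z_mx g) \in unitmx.
Proof. by rewrite unitmx_inv (valP g). Qed.

Definition GL2Z_one : GL2Z := Sub 1%:M GL2Z_one_subproof.
Definition GL2Z_mul g h : GL2Z :=
  Sub (GL2Z_mx g *m GL2Z_mx h) (GL2Z_mul_subproof g h).
Definition GL2Z_inv g : GL2Z := Sub (invmx (GL2Z_mx g)) (GL2Z_inv_subproof g).

Fact GL2Z_mulA : associative GL2Z_mul.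
Proof. by move=> f g h; apply: val_inj; rewrite /= mulmxA. Qed.
Fact GL2Z_1mul : left_id GL2Z_one GL2Z_mul.
Proof. by move=> g; apply: val_inj; rewrite /= mul1mx. Qed.
Fact GL2Z_mul1 : right_id GL2Z_one GL2Z_mul.
Proof. by move=> g; apply: val_inj; rewrite /= mulmx1. Qed.
Fact GL2Z_Vmul : left_inverse GL2Z_one GL2Z_inv GL2Z_mul.
Proof. by move=> g; apply: val_inj; rewrite /= mulVmx // (valP g). Qed.
Fact GL2Z_mulV : right_inverse GL2Z_one GL2Z_inv GL2Z_mul.
Proof. by move=> g; apply: val_inj; rewrite /= mulmxV // (valP g). Qed.

HB.instance Definition _ := isGroup.Build GL2Z
  GL2Z_mulA GL2Z_1mul GL2Z_mul1 GL2Z_Vmul GL2Z_mulV.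

End GL2ZGroup.

Section Torus.
Variable R : realType.
Local Open Scope quotient_scope.

(* Z^2 as a subgroup of R^2 (column vectors with integer entries). *)
Definition Z2 : {pred 'cV[R]_2} := mxOver_pred Num.int.

Fact Z2_zmod_closed : zmod_closed Z2.
Proof.
split=> [|u v /mxOverP uZ /mxOverP vZ]; apply/mxOverP => i j; rewrite !mxE.
  exact: rpred0.
by rewrite rpredB.
Qed.
HB.instance Definition _ := GRing.isZmodClosed.Build _ Z2 Z2_zmod_closed.

Definition torus : Type := quotient_topology {ideal_quot Z2}.
HB.instance Definition _ := Topological.on torus.
HB.instance Definition _ := Quotient.on torus.
HB.instance Definition _ := GRing.Zmodule.copy torus {ideal_quot Z2}.
HB.instance Definition _ := isPointed.Build torus (0 : torus).

(* The Borel sigma-algebra of the quotient topology. *)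
HB.instance Definition _ :=
  Measurable.copy torus (g_sigma_algebraType (@open torus)).

Definition torus_act (g : GL2Z) (x : torus) : torus :=
  \pi_torus (map_mx intr (GL2Z_mx g) *m repr x).

Lemma torus_pi_eq (u v : 'cV[R]_2) :
  (\pi_torus u = \pi_torus v) <-> u - v \in Z2.
Proof.
rewrite Quotient.idealrBE.
by split => [e|/eqP //]; apply/eqP.
Qed.

Lemma torus_act_pi (g : GL2Z) (v : 'cV[R]_2) :
  torus_act g (\pi_torus v) = \pi_torus (map_mx intr (GL2Z_mx g) *m v).
Proof.
apply/torus_pi_eq; rewrite -mulmxBr.
have /mxOverP dZ : repr (\pi_torus v) - v \in Z2.
  by apply/torus_pi_eq; exact: reprK.
apply/mxOverP => i j; rewrite mxE rpred_sum // => k _.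
by rewrite rpredM // mxE intr_int.
Qed.

(* [probability] provides the normalization nu(T^2) = 1. *)
Definition normalized_haar (nu : probability torus R) : Prop :=
  forall (t : torus) (A : set torus),
    measurable A -> nu [set t + x | x in A] = nu A.

(* Complex-valued functions; measurability and integration are taken
   componentwise. *)
Implicit Types (nu : probability torus R) (f : torus -> R[i]) (A : set GL2Z).

Definition cmeasurable f : Prop :=
  measurable_fun setT (fun x => complex.Re (f x)) /\
  measurable_fun setT (fun x => complex.Im (f x)).

Definition cintegral nu f : R[i] :=
  Complex (Rintegral nu setT (fun x => complex.Re (f x)))
          (Rintegral nu setT (fun x => complex.Im (f x))).

(* Functions are Borel representatives, not classes modulo nu-null sets. *)
Definition L2norm nu f : \bar R :=
  'N[nu]_2%:E[(fun x => (Normc.normc (f x))%:E)]%E.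

Definition in_L2 nu f : Prop := cmeasurable f /\ (L2norm nu f < +oo)%E.

Definition average A f (x : torus) : R[i] :=
  (#|` fset_set A|%:R)^-1 * \sum_(g \in A) f (torus_act g x).

Definition sup_deviation nu A : \bar R :=
  ereal_sup [set L2norm nu (fun x => average A f x - cintegral nu f)
            | f in [set f | in_L2 nu f /\ L2norm nu f = 1%E]].

End Torus.

(* Main.v *)
Require Import Defs.
From HB Require Import structures.
From mathcomp Require Import all_boot all_order all_algebra archimedean.
From mathcomp Require Import finmap.
From mathcomp Require Import all_classical all_reals all_analysis.
From mathcomp Require Import complex measurable_realfun.
From mathcomp Require Import zify ring lra.

Set Implicit Arguments.
Unset Strict Implicit.
Unset Printing Implicit Defensive.

Import Order.TTheory GRing.Theory Num.Theory.
Import numFieldNormedType.Exports.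

Local Open Scope classical_set_scope.
Local Open Scope ring_scope.

(** Both suprema are norms of an averaging operator on the functions of mean zero,
    and both norms are read off from one function on the free group: the spherical
    function [phi g = (1 + (q - 1) / (q + 1) * |g|) * q ^ (- |g| / 2)]. It is
    positive, equals 1 at the identity, and for a sphere or a ball [D] the sum of
    [phi (d * g)] over [d] in [D] is [Lam * phi g] ([spherical_sphere]). The claim is
    that the norm is [Lam] divided by the cardinal of [D].

    Returns. Summing [phi] over the end points of the walks of length [k] with steps
    in [D] gives [Lam ^ k]. Positivity bounds the number of closed walks by
    [Lam ^ k] ([returns_le]). Conversely the sum of [phi ^ 2] over a ball grows only
    polynomially with the radius, and Cauchy-Schwarz bounds the number of closed walks
    of length [2k] from below by [Lam ^ 2k], up to that polynomial ([returns_ge]).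

    From the group to the torus. The action sends the wave of frequency [v] to the wave
    of frequency [v g]. The squared norm of the k-th power of the sum over [D], applied
    to a wave, is therefore governed by the walks of length [2k] that fix [v] up to
    sign. The closed walks are among them, which gives the lower bound
    ([trig_norm_ge]). The stabilizer of a nonzero [v] up to sign consists of integer
    matrices that are triangular in a suitable basis; one integer, the shear, describes
    such a matrix up to signs and is subadditive, so that this group grows linearly in
    the shear. Concatenating [p] walks that end in the stabilizer and letting [p] grow
    shows that there are at most [Lam ^ 2k] of them ([stabilizer_returns]). Symmetry of
    the operator makes the norms of its powers log-convex, and the bound on all powers
    becomes a bound on the first ([trig_contraction]).

    Density. Trigonometric polynomials approximate indicators of small open sets,
    hence of all Borel sets ([approximable_indic]), hence simple functions; Fatou's
    lemma extends the upper bound to all square integrable functions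
    ([deviation_L2]), and complex functions split into real and imaginary parts. *)

(** * Counting coincidences in lists *)

Section ListSums.
Variable R : realFieldType.

Lemma ler_sum_subset (I : eqType) (s t : seq I) (F : I -> R) :
  uniq s -> {subset s <= t} -> (forall i, 0 <= F i) ->
  \sum_(i <- s) F i <= \sum_(i <- t) F i.
Proof.
move=> us + F0; elim: s us t => [|x s IH] /=.
  by move=> _ t _; rewrite big_nil sumr_ge0.
move=> /andP[xs us] t st.
have xt : x \in t by apply: st; rewrite mem_head.
rewrite big_cons (perm_big _ (perm_to_rem xt)) big_cons lerD2l IH // => y ys.
have : y \in x :: rem x t by rewrite -(perm_mem (perm_to_rem xt)) st // in_cons ys orbT.
by rewrite in_cons => /orP[/eqP yx|//]; rewrite -yx ys in xs.
Qed.

Lemma sum_undup (I : eqType) (s : seq I) (F : I -> R) :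
  \sum_(i <- s) F i = \sum_(y <- undup s) (count_mem y s)%:R * F y.
Proof.
under [RHS]eq_bigr do rewrite mulr_natl.
exact/esym/big_undup_iterop_count.
Qed.

Lemma sum_undup_sub (I : eqType) (s t : seq I) (F : I -> R) : {subset s <= t} ->
  \sum_(i <- s) F i = \sum_(y <- undup t) (count_mem y s)%:R * F y.
Proof.
move=> st; rewrite sum_undup.
have -> : \sum_(y <- undup t) (count_mem y s)%:R * F y =
    \sum_(y <- undup t | y \in s) (count_mem y s)%:R * F y.
  rewrite [RHS]big_mkcond /=; apply: eq_bigr => y _; case: ifPn => // ys.
  by rewrite (count_memPn ys) mul0r.
rewrite -[RHS]big_filter; apply: perm_big; apply: uniq_perm.
- exact: undup_uniq.
- by rewrite filter_uniq // undup_uniq.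
- move=> y; rewrite mem_filter !mem_undup; case: (boolP (y \in s)) => // /st ->.
  by [].
Qed.

Lemma sum_eq_count (I : eqType) (s : seq I) (x : I) :
  \sum_(b <- s) (x == b)%:R = (count_mem x s)%:R :> R.
Proof.
rewrite -sum1_count natr_sum [RHS]big_mkcond /=; apply: eq_bigr => b _.
by rewrite eq_sym; case: eqP.
Qed.

(** Grouping the pairs with equal entries by their common value turns coincidences
    into an inner product of multiplicity functions. *)
Lemma sum_coincidence (I : eqType) (s t u : seq I) : {subset s <= u} ->
  \sum_(x <- s) \sum_(y <- t) (x == y)%:R =
  \sum_(y <- undup u) (count_mem y s)%:R * (count_mem y t)%:R :> R.
Proof.
move=> su; under eq_bigr do rewrite sum_eq_count.
by rewrite (sum_undup_sub (fun x => (count_mem x t)%:R) su).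
Qed.

(** The difference of the two sides is a sum of squares of differences of multiplicities. *)
Lemma coincidence_le (I : eqType) (s t : seq I) :
  2 * \sum_(x <- s) \sum_(y <- t) (x == y)%:R <=
  \sum_(x <- s) \sum_(y <- s) (x == y)%:R +
  \sum_(x <- t) \sum_(y <- t) (x == y)%:R :> R.
Proof.
have su : {subset s <= s ++ t} by move=> y ys; rewrite mem_cat ys.
have tu : {subset t <= s ++ t} by move=> y ys; rewrite mem_cat ys orbT.
rewrite (sum_coincidence _ su) (sum_coincidence _ su) (sum_coincidence _ tu).
rewrite mulr_sumr -big_split /=; apply: ler_sum => y _.
by have := sqr_ge0 ((count_mem y s)%:R - (count_mem y t)%:R : R); nra.
Qed.

(** The discriminant criterion, including the degenerate case [C = 0]; it ends both
    proofs of Cauchy-Schwarz inequalities below. *)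
Lemma sqr_le_of_quadratic (A B C : R) : 0 <= B -> 0 <= C ->
  (forall t, 2 * t * A <= B + t ^+ 2 * C) -> A ^+ 2 <= B * C.
Proof.
move=> B0 C0 CE; have [C00|C00] := eqVneq C 0; last first.
  have := CE (A / C); rewrite expr_div_n -[_ * _ * A]mulrA => h.
  have /(ler_wpM2r C0) : 2 * (A / C * A) - A ^+ 2 / C ^+ 2 * C <= B by lra.
  suff -> : (2 * (A / C * A) - A ^+ 2 / C ^+ 2 * C) * C = A ^+ 2 by [].
  by field.
have A0 : A = 0; last by rewrite A0 expr0n mulr_ge0.
apply/eqP; case: (eqVneq A 0) => // An.
have := CE ((B + 1) / A); rewrite C00 mulr0 addr0.
have -> : 2 * ((B + 1) / A) * A = 2 * (B + 1) by field.
lra.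
Qed.

(** Cauchy-Schwarz, for the multiplicities of [s] against the values of [F]. *)
Lemma sum_sqr_le (I : eqType) (s : seq I) (F : I -> R) :
  (\sum_(x <- s) F x) ^+ 2 <=
  (\sum_(x <- s) \sum_(y <- s) (x == y)%:R) * \sum_(x <- undup s) F x ^+ 2.
Proof.
rewrite (@sum_coincidence _ s s s) // sum_undup.
apply: sqr_le_of_quadratic.
- by apply: sumr_ge0 => y _; rewrite mulr_ge0.
- by apply: sumr_ge0 => y _; exact: sqr_ge0.
move=> t; rewrite !mulr_sumr -big_split /=; apply: ler_sum => y _.
by have := sqr_ge0 ((count_mem y s)%:R - t * F y); nra.
Qed.

End ListSums.

(** * Reduced words and word length *)

Section Words.
Local Open Scope group_scope.
Variables (G : groupType) (r : nat) (a : 'I_r -> G).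
Local Notation L := ('I_r * bool)%type.
Implicit Types (l m : L) (w u : seq L) (g : G).

Definition linv l : L := (l.1, ~~ l.2).

Lemma linvK : involutive linv.
Proof. by case=> i b; rewrite /linv /= negbK. Qed.

Lemma linv_sym l m : (l == linv m) = (m == linv l).
Proof. by rewrite -(inj_eq (can_inj linvK)) linvK eq_sym. Qed.

Definition ev w : G := \prod_(l <- w) letter a l.

Lemma ev_nil : ev [::] = 1.
Proof. by rewrite /ev big_nil. Qed.

Lemma ev_cons l w : ev (l :: w) = letter a l * ev w.
Proof. by rewrite /ev big_cons. Qed.

Lemma ev_cat w u : ev (w ++ u) = ev w * ev u.
Proof. by rewrite /ev big_cat. Qed.

Lemma letter_linv l : letter a (linv l) = (letter a l)^-1.
Proof. by case: l => i [] //=; rewrite /letter /= invgK. Qed.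

Definition winv w := rev (map linv w).

Lemma ev_winv w : ev (winv w) = (ev w)^-1.
Proof.
rewrite /winv; elim: w => [|l w IH] /=; first by rewrite ev_nil invg1.
by rewrite rev_cons -cats1 ev_cat IH !ev_cons invgM ev_nil mulg1 letter_linv.
Qed.

Definition extendable l w := if w is m :: _ then m != linv l else true.

Lemma reduced_rel l m :
  ~~ ((l.1 == m.1) && (l.2 != m.2)) = (m != linv l).
Proof. by case: l m => i [] [j []]; rewrite /linv !xpair_eqE /= ?andbT ?andbF // eq_sym. Qed.

Lemma reduced_cons l w : reduced (l :: w) = extendable l w && reduced w.
Proof. by case: w => [|m w] //=; rewrite reduced_rel. Qed.

Lemma reduced_winv w : reduced (winv w) = reduced w.
Proof.
rewrite /reduced /winv rev_sorted sorted_map.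
by apply: eq_sorted => -[i []] [j []] /=; rewrite eq_sym.
Qed.

Lemma reduced_rcons_cat u l m w :
  reduced (rcons u l) -> m != linv l -> reduced (m :: w) ->
  reduced (rcons u l ++ m :: w).
Proof.
case: u => [|k u] /=.
  by move=> _ h h'; rewrite /reduced /= reduced_rel h.
rewrite /reduced /= cat_path => -> h h' /=.
by rewrite last_rcons reduced_rel h.
Qed.

Definition free_words := forall w, reduced w -> w <> [::] -> ev w <> 1.

(** After the common prefix is cancelled, the quotient of two distinct reduced words
    is again a nonempty reduced word. *)
Lemma ev_inj w u : free_words -> reduced w -> reduced u -> ev w = ev u -> w = u.
Proof.
move=> free; elim: w u => [|l w IH] [|m u] rw ru // e.
- by case: (free _ ru) => //; rewrite -e ev_nil.
- by case: (free _ rw) => //; rewrite e ev_nil.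
have [lm|lm] := eqVneq l m.
  move: e rw ru; rewrite !ev_cons !reduced_cons -lm => /mulgI e.
  by move=> /andP[_ rw] /andP[_ ru]; rewrite (IH u).
have := @free (winv (l :: w) ++ m :: u).
rewrite ev_cat ev_winv -e mulVg /winv /= rev_cons; case=> //.
  apply: reduced_rcons_cat => //; last by rewrite linvK eq_sym.
  by move: rw; rewrite -reduced_winv /winv /= rev_cons.
by case: (rev _).
Qed.

Lemma reduceP w :
  exists u, [/\ reduced u, ev u = ev w & (size u <= size w)%N].
Proof.
elim: w => [|l w [u [ru eu su]]]; first by exists [::].
have [h|] := boolP (extendable l u).
  by exists (l :: u); rewrite reduced_cons h ru !ev_cons eu.
case: u ru eu su => [|m u] //; rewrite reduced_cons => /andP[_ ru] eu su.
rewrite negbK => /eqP em; exists u; split => //; last first.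
  exact: leq_trans (ltnW su) (leqnSn _).
by rewrite ev_cons -eu ev_cons em letter_linv mulVKg.
Qed.

Lemma gens_letter g :
  symmetric_generators a g <-> exists l, g = letter a l.
Proof.
split; first by case=> -[i _ <-]; [exists (i, false) | exists (i, true)].
by case=> -[i []] ->; [right | left]; exists i.
Qed.

Lemma is_productP k g :
  is_product (symmetric_generators a) k g <-> exists2 w, size w = k & ev w = g.
Proof.
split=> [[t [tS ->]]|[w <- <-]].
  have /choice[f fE] : forall i, exists l, tnth t i = letter a l.
    by move=> i; apply/gens_letter/tS.
  exists [tuple f i | i < k]; first by rewrite size_tuple.
  by rewrite /ev big_tuple; apply: eq_bigr => i _; rewrite tnth_mktuple -fE.
exists [tuple of map (letter a) (in_tuple w)]; split.
  by move=> i; rewrite tnth_map; apply/gens_letter; exists (tnth (in_tuple w) i).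
rewrite /ev (big_tnth _ _ w); apply: eq_bigr => i _.
by rewrite tnth_map.
Qed.

Lemma ev_generated w : generated_subgroup (range a) (ev w).
Proof.
move=> H [[H1 HD] aH].
have HV g : H g -> H g^-1 by move=> Hg; rewrite -[g^-1]mul1g; exact: HD.
have HM g h : H g -> H h -> H (g * h).
  by move=> Hg Hh; rewrite -[h]invgK; apply: HD => //; apply: HV.
elim: w => [|l w IH]; first by rewrite ev_nil.
rewrite ev_cons; apply: HM => //; rewrite /letter.
by case: ifP => _; [apply: HV|]; apply: aH; exists l.1.
Qed.

(** Cancellation never lengthens a word, and reduced words are unique: the word length
    is the size of the reduced word. *)
Lemma has_word_lengthP g n : free_words ->
  has_word_length (symmetric_generators a) g n <->
  exists w, [/\ reduced w, size w = n & ev w = g].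
Proof.
move=> free; split=> [[/is_productP[w sw <-] min]|[w [rw <- <-]]].
  have [u [ru eu su]] := reduceP w; exists u; split => //.
  apply/eqP; rewrite eqn_leq -{1}sw su; apply: min; apply/is_productP.
  by exists u.
split; first by apply/is_productP; exists w.
move=> j /is_productP[v <- ev_v].
have [u [ru eu su]] := reduceP v.
by rewrite -(@ev_inj u w) // eu.
Qed.

(** Words grow by their first letter, so that a sum over a sphere can be compared with
    the sums over the two preceding spheres. *)
Fixpoint rwords n : seq (seq L) :=
  if n is k.+1 then
    flatten [seq [seq l :: w | l <- enum {: L} & extendable l w] | w <- rwords k]
  else [:: [::]].

Lemma mem_rwords n w : (w \in rwords n) = (size w == n) && reduced w.
Proof.
elim: n w => [|n IH] w /=; first by case: w.
apply/flatten_mapP/andP => [[u]|[]].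
  rewrite IH => /andP[/eqP <- ru] /mapP[l]; rewrite mem_filter => /andP[h _] ->.
  by rewrite reduced_cons h ru.
case: w => [|l w]; first by [].
rewrite reduced_cons => /eqP[sw] /andP[h rw].
exists w; first by rewrite IH rw sw eqxx.
by apply/mapP; exists l => //; rewrite mem_filter h mem_enum.
Qed.

Lemma rwords_uniq n : uniq (rwords n).
Proof.
elim: n => [|n IH] //=; apply: allpairs_uniq_dep => //.
- by move=> w _; rewrite filter_uniq // enum_uniq.
- by move=> [w l] [u m] _ _ /= [-> ->].
Qed.
End Words.

(** * The spherical function of the free group *)

Section Spherical.
Variables (R : realType) (G : groupType) (r : nat) (a : 'I_r -> G).
Local Notation L := ('I_r * bool)%type.
Hypothesis free : free_words a.
Variable s : R.
Hypothesis s0 : 0 < s.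
Hypothesis sE : s ^+ 2 = 2 * r%:R - 1.
Implicit Types (l m : L) (w u : seq L) (g : G).
Local Notation q := (s ^+ 2).

(** With [s] the square root of [q], this is the radial eigenfunction of the
    [q + 1]-regular tree for the eigenvalue [2 * s], the largest one of the tempered
    spectrum: [psi (size w)] decays like the square root of the inverse sphere size, up to
    a linear factor. *)
Definition psi (j : nat) : R := (1 + (q - 1) / (q + 1) * j%:R) * s ^- j.

Lemma q1_neq0 : q + 1 != 0.
Proof. by rewrite gt_eqF // ltr_wpDl // sqr_ge0. Qed.

Lemma psi0 : psi 0 = 1.
Proof. by rewrite /psi mulr0 addr0 expr0 invr1 mulr1. Qed.

Lemma psi1 : (q + 1) * psi 1 = 2 * s.
Proof. rewrite /psi expr1; field. by rewrite gt_eqF //= q1_neq0. Qed.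

(** The eigenvalue equation at distance [k.+1] from the root: one neighbour is nearer,
    [q] are farther. *)
Lemma psi_rec k : q * psi k.+2 + psi k = 2 * s * psi k.+1.
Proof.
rewrite /psi !exprS -!natr1.
have sk : s ^+ k != 0 by rewrite expf_neq0 // gt_eqF.
field; do ?[apply/andP; split]; rewrite ?gt_eqF ?exprn_gt0 //.
by rewrite ltr_wpDl // sqr_ge0.
Qed.

Lemma card_letters : #|{: L}|%:R = q + 1 :> R.
Proof. by rewrite card_prod card_ord card_bool natrM sE; ring. Qed.

Lemma q_ge1 : (0 < r)%N -> 1 <= q.
Proof.
move=> r0; have : 1 <= r%:R :> R by rewrite ler1n.
by rewrite sE; lra.
Qed.

Lemma psi_gt0 j : (0 < r)%N -> 0 < psi j.
Proof.
move=> /q_ge1 q1; rewrite /psi mulr_gt0 ?invr_gt0 ?exprn_gt0 //.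
by rewrite ltr_pwDl // mulr_ge0 // divr_ge0 //; lra.
Qed.

Definition extensions w : R := \sum_(l : L | extendable l w) 1.

Lemma extensionsE w : extensions w = if w is [::] then q + 1 else q.
Proof.
rewrite /extensions; case: w => [|m w] /=.
  by rewrite sumr_const card_letters.
have := card_letters; rewrite -sumr_const (bigD1 (linv m)) //=.
rewrite (eq_bigl (fun l => m != linv l)); last first.
  by move=> l /=; rewrite linv_sym.
lra.
Qed.

Lemma sum_rwordsS n (F : seq L -> R) :
  \sum_(w <- rwords r n.+1) F w =
  \sum_(w <- rwords r n) \sum_(l | extendable l w) F (l :: w).
Proof.
rewrite /= big_flatten big_map; apply: eq_bigr => w _.
by rewrite big_map big_filter big_enum_cond.
Qed.

Definition branching n : R := if n is 0%N then q + 1 else q.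

Lemma extensions_rwords n w : w \in rwords r n -> extensions w = branching n.
Proof.
by rewrite mem_rwords extensionsE => /andP[/eqP <- _]; case: w.
Qed.

Lemma sum_behead n (F : seq L -> R) :
  \sum_(w <- rwords r n.+1) F (behead w) =
  branching n * \sum_(w <- rwords r n) F w.
Proof.
rewrite sum_rwordsS mulr_sumr; apply: eq_big_seq => w wn /=.
rewrite -(extensions_rwords wn) /extensions mulr_suml.
by apply: eq_bigr => l _; rewrite mul1r.
Qed.

Definition sphere_card n : R := (size (rwords r n))%:R.

Lemma sphere_cardS n : sphere_card n.+1 = branching n * sphere_card n.
Proof.
have H k : sphere_card k = \sum_(w <- rwords r k) 1.
  by rewrite /sphere_card -sum1_size natr_sum.
by rewrite !H -sum_behead.
Qed.

(** The value 0 outside the subgroup makes the eigenvalue equations below hold at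
    every [g]. *)
Definition spherical g : R :=
  if `[< exists w, reduced w /\ ev a w = g >]
  then psi (size (xget [::] [set w | reduced w /\ ev a w = g])) else 0.

Lemma spherical_ev w : reduced w -> spherical (ev a w) = psi (size w).
Proof.
move=> rw; rewrite /spherical asboolT; last by exists w.
case: xgetP => [u _ [ru eu]|/(_ w)]; last by case.
by rewrite (ev_inj free ru rw eu).
Qed.

Lemma spherical_notin g : (forall w, ev a w <> g) -> spherical g = 0.
Proof. by move=> h; rewrite /spherical asboolF // => -[w [_ /h]]. Qed.

Lemma spherical1 : spherical 1%g = 1.
Proof. by rewrite -(ev_nil a) spherical_ev // psi0. Qed.

(** Exactly one letter shortens a nonempty reduced word, the inverse of its first letter. *)
Lemma spherical_neighbours g :
  \sum_(l : L) spherical (letter a l * g)%g = 2 * s * spherical g.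
Proof.
have [[w <-]|h] := pselect (exists w, ev a w = g); last first.
  rewrite spherical_notin ?mulr0; last by move=> w e; apply: h; exists w.
  rewrite big1 // => l _; rewrite spherical_notin // => w e; apply: h.
  by exists (linv l :: w); rewrite ev_cons letter_linv e mulKg.
have [{w} w rw <-] : exists2 u, reduced u & ev a u = ev a w.
  by have [u [ru eu _]] := reduceP a w; exists u.
case: w rw => [|m w] rw.
  rewrite spherical_ev // psi0 mulr1 -psi1 -card_letters mulr_natl -sumr_const.
  apply: eq_bigr => l _.
  by rewrite ev_nil mulg1 -[letter a l]mulg1 -(ev_nil a) -ev_cons spherical_ev.
rewrite (bigD1 (linv m)) //=.
rewrite ev_cons letter_linv mulKg -ev_cons.
move: (rw); rewrite reduced_cons => /andP[_ rw'].
rewrite !spherical_ev // -psi_rec addrC; congr (_ + _).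
have := extensionsE (m :: w); rewrite /extensions /= => <-.
rewrite mulr_suml; apply: eq_big => [l|l lm].
  by rewrite linv_sym.
rewrite -ev_cons spherical_ev ?mul1r // reduced_cons rw andbT /=.
by rewrite linv_sym.
Qed.

(** The sum over a sphere is a polynomial in the sum over the letters: an arbitrary letter
    put before the words of size [k.+1] gives the words of size [k.+2] and, with
    multiplicity [branching k], those of size [k]. *)
Lemma spherical_sphere n g :
  \sum_(w <- rwords r n) spherical (ev a w * g)%g =
  sphere_card n * psi n * spherical g.
Proof.
pose T n := \sum_(w <- rwords r n) spherical (ev a w * g)%g.
have TS k : T k.+2 = 2 * s * T k.+1 - branching k * T k.
  rewrite /T -(sum_behead k (fun w => spherical (ev a w * g)%g)) mulr_sumr.
  rewrite sum_rwordsS -sumrB; apply: eq_big_seq => -[|m w]; rewrite mem_rwords //= => _.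
  rewrite -spherical_neighbours [in RHS](bigD1 (linv m)) //=.
  rewrite ev_cons letter_linv mulgA mulKg addrAC subrr add0r.
  apply: eq_big => l; first by rewrite linv_sym.
  by rewrite !ev_cons !mulgA.
rewrite -/(T n); suff [//] : T n = sphere_card n * psi n * spherical g /\
   T n.+1 = sphere_card n.+1 * psi n.+1 * spherical g.
elim: n => [|n [IH1 IH2]].
  rewrite {1}/T /= big_seq1 ev_nil mul1g /sphere_card /= psi0 mulr1 mul1r; split => //.
  rewrite -/(sphere_card 1) sphere_cardS /sphere_card /= mulr1 psi1.
  rewrite -spherical_neighbours /T sum_rwordsS big_seq1 /=.
  by apply: eq_bigr => l _; rewrite ev_cons ev_nil mulg1.
split=> //; rewrite TS IH1 IH2 [sphere_card n.+2]sphere_cardS.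
have -> : branching n * (sphere_card n * psi n * spherical g) =
  sphere_card n.+1 * psi n * spherical g by rewrite sphere_cardS; ring.
have qE : q * psi n.+2 = 2 * s * psi n.+1 - psi n by rewrite -psi_rec; ring.
have -> : branching n.+1 * sphere_card n.+1 * psi n.+2 * spherical g =
  sphere_card n.+1 * spherical g * (q * psi n.+2) by rewrite /branching; ring.
by rewrite qE; ring.
Qed.

Lemma spherical_ge0 g : (0 < r)%N -> 0 <= spherical g.
Proof. by rewrite /spherical => r0; case: ifP => // _; apply: ltW; exact: psi_gt0. Qed.

Lemma sphere_cardE n : sphere_card n = if n is k.+1 then (q + 1) * q ^+ k else 1.
Proof.
case: n => [|n]; first by rewrite /sphere_card.
elim: n => [|n IH]; rewrite sphere_cardS; first by rewrite /sphere_card /= !mulr1.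
by rewrite IH /branching [q ^+ n.+1]exprS; ring.
Qed.

(** The growth of the spheres cancels the decay of [psi ^+ 2] up to a polynomial; this is
    why the return estimates are sharp on the exponential scale. *)
Lemma sphere_psi2_le j : (0 < r)%N -> sphere_card j * psi j ^+ 2 <= 2 * j.+1%:R ^+ 2.
Proof.
move=> /q_ge1 q1; rewrite sphere_cardE; case: j => [|j].
  by rewrite psi0 expr1n; lra.
have -> : (q + 1) * q ^+ j * psi j.+1 ^+ 2 =
  (1 + q^-1) * (1 + (q - 1) / (q + 1) * j.+1%:R) ^+ 2.
  rewrite /psi -[(s ^+ 2) ^+ j]exprM mulnC exprM [s ^+ j.+1]exprS.
  have sj : s ^+ j != 0 by rewrite expf_neq0 // gt_eqF.
  field; do ?[apply/andP; split]; rewrite ?gt_eqF // ?exprn_gt0 //.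
  by rewrite ltr_wpDl // sqr_ge0.
have h1 : q^-1 <= 1 by rewrite invf_le1 // (lt_le_trans _ q1).
have h0 : 0 <= (q - 1) / (q + 1) by rewrite divr_ge0 //; lra.
have h2 : (q - 1) / (q + 1) <= 1 by rewrite ler_pdivrMr; lra.
rewrite ler_pM //.
- by rewrite addr_ge0 // invr_ge0 sqr_ge0.
- by rewrite sqr_ge0.
- by rewrite [2](_ : _ = 1 + 1) // lerD2l.
have b0 : 0 <= 1 + (q - 1) / (q + 1) * j.+1%:R by rewrite addr_ge0 // mulr_ge0 // ler0n.
rewrite ler_pXn2r ?nnegrE ?ler0n //.
have -> : j.+2%:R = 1 + j.+1%:R :> R by rewrite -[in LHS]natr1 addrC.
by rewrite lerD2l ler_piMl ?ler0n.
Qed.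

Lemma spherical_l2 n (t : seq G) : (0 < r)%N -> uniq t ->
  (forall g, g \in t -> exists2 w, (size w <= n)%N & ev a w = g) ->
  \sum_(g <- t) spherical g ^+ 2 <= 2 * n.+1%:R ^+ 3.
Proof.
move=> r0 ut th.
pose u := [seq ev a w | w <- flatten [seq rwords r j | j <- iota 0 n.+1]].
have tu : {subset t <= u}.
  move=> g /th[w wn <-]; have [v [rv ev su]] := reduceP a w.
  rewrite -ev; apply: map_f; apply/flatten_mapP; exists (size v).
    by rewrite mem_iota ltnS (leq_trans su).
  by rewrite mem_rwords eqxx.
apply: le_trans (ler_sum_subset ut tu _) _; first by move=> g; exact: sqr_ge0.
rewrite big_map big_flatten big_map -[iota 0 n.+1]/(index_iota 0 n.+1).
apply: (@le_trans _ _ (\sum_(0 <= j < n.+1) 2 * n.+1%:R ^+ 2)).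
  rewrite !big_nat; apply: ler_sum => j jn; rewrite big_seq.
  under eq_bigr => w wj.
    move: wj; rewrite mem_rwords => /andP[/eqP wj rw].
    rewrite spherical_ev // wj; over.
  rewrite -big_seq big_const_seq count_predT iter_addr_0 -[leLHS]mulr_natl.
  apply: le_trans (sphere_psi2_le j r0) _.
  by rewrite ler_wpM2l // ler_pXn2r ?nnegrE // ler_nat.
by rewrite sumr_const_nat subn0 -[leLHS]mulr_natl exprS mulrCA.
Qed.
End Spherical.

(** * Walks and returns *)

Section Walks.
Local Open Scope group_scope.
Variable G : groupType.
Implicit Types (D s t : seq G) (g h : G) (k m : nat).

(** A list rather than a set: the multiplicity of [g] counts the walks that end at [g]. *)
Fixpoint walks D k : seq G :=
  if k is j.+1 then [seq d * g | d <- D, g <- walks D j] else [:: 1].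

Definition symmetric_seq D := perm_eq [seq g^-1 | g <- D] D.

Section Sums.
Variable R : realType.
Implicit Type F : G -> R.

Lemma sum_walksS D k F :
  (\sum_(g <- walks D k.+1) F g)%R =
  (\sum_(d <- D) \sum_(g <- walks D k) F (d * g)%g)%R.
Proof. by rewrite /= big_allpairs_dep. Qed.

Lemma sum_walksD D k m F :
  (\sum_(g <- walks D (k + m)) F g)%R =
  (\sum_(g <- walks D k) \sum_(h <- walks D m) F (g * h)%g)%R.
Proof.
elim: k F => [|k IH] F.
  by rewrite add0n /= big_seq1; apply: eq_bigr => g _; rewrite mul1g.
rewrite addSn !sum_walksS; apply: eq_bigr => d _; rewrite IH.
by apply: eq_bigr => g _; apply: eq_bigr => h _; rewrite mulgA.
Qed.

Lemma sum_walksSr D k F :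
  (\sum_(g <- walks D k.+1) F g)%R =
  (\sum_(g <- walks D k) \sum_(d <- D) F (g * d)%g)%R.
Proof.
rewrite -addn1 sum_walksD; apply: eq_bigr => g _.
rewrite sum_walksS; apply: eq_bigr => d _.
by rewrite /= big_seq1 mulg1.
Qed.

(** Reversing a walk inverts its end point. *)
Lemma sum_walksV D k F : symmetric_seq D ->
  (\sum_(g <- walks D k) F g^-1%g)%R = (\sum_(g <- walks D k) F g)%R.
Proof.
move=> sD; elim: k F => [|k IH] F; first by rewrite /= !big_seq1 invg1.
rewrite sum_walksS [RHS]sum_walksSr exchange_big /=.
under eq_bigr => g _.
  rewrite (eq_bigr (fun d => F (g^-1 * d^-1)%g)); last by move=> d _; rewrite invgM.
  over.
rewrite (IH (fun g => \sum_(d <- D) F (g * d^-1)%g)%R); apply: eq_bigr => g _.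
rewrite -(perm_big _ sD) big_map /=.
by apply: eq_bigr => d _; rewrite invgK.
Qed.

(** A pair of walks whose end points differ by [g] becomes, once the second is reversed,
    a walk of double length that ends at [g]. *)
Lemma sum_walks_coincide D k g : symmetric_seq D ->
  (\sum_(x <- walks D k) \sum_(y <- walks D k) (x == (g * y)%g)%:R)%R =
  ((count_mem g (walks D (k + k)))%:R : R)%R.
Proof.
move=> sD; rewrite -sum_eq_count sum_walksD; apply: eq_bigr => x _.
rewrite -(sum_walksV _ (fun y => (g == (x * y)%g)%:R)%R sD).
by apply: eq_bigr => y _; rewrite [in RHS]eq_sym divg_eq.
Qed.

(** Walk counts of even length are positive definite, hence largest at the identity. *)
Lemma count_walks_le D k g : symmetric_seq D ->
  (count_mem g (walks D (k + k)) <= count_mem 1%g (walks D (k + k)))%N.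
Proof.
move=> sD; rewrite -(ler_nat R) -!sum_walks_coincide //.
have := coincidence_le R (walks D k) [seq g * y | y <- walks D k].
rewrite !big_map; under [X in (2 * X)%R]eq_bigr do rewrite big_map.
under [X in (_ <= _ + X)%R]eq_bigr => x _.
  rewrite big_map; under eq_bigr do rewrite (inj_eq (mulgI g)).
  over.
under [X in (_ -> _ <= X)%R]eq_bigr do under eq_bigr do rewrite mul1g.
lra.
Qed.

Section PositiveEigenfunction.
Local Open Scope ring_scope.
Variables (D : seq G) (phi : G -> R) (Lam : R).
Hypotheses (phi1 : phi 1%g = 1) (phi_ge0 : forall g, 0 <= phi g).
Hypothesis eigen : forall g, \sum_(d <- D) phi (d * g)%g = Lam * phi g.

Lemma sum_walks_eigen k : \sum_(g <- walks D k) phi g = Lam ^+ k.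
Proof.
elim: k => [|k IH]; first by rewrite /= big_seq1 phi1.
rewrite sum_walksS exchange_big /=.
by under eq_bigr do rewrite eigen; rewrite -mulr_sumr IH exprS.
Qed.

(** Among the nonnegative terms of [sum_walks_eigen], keep those at the identity. *)
Lemma returns_le k : (count_mem 1%g (walks D k))%:R <= Lam ^+ k.
Proof.
rewrite -sum_walks_eigen -sum_eq_count; apply: ler_sum => g _.
by case: eqP => [<-|_] //; rewrite phi1.
Qed.

(** Cauchy-Schwarz in [sum_walks_eigen]: the squared multiplicities add up to the number
    of returns in [k + k] steps. Together with [returns_le] this identifies the exponential
    rate of the returns as soon as the sum of squares grows polynomially. *)
Lemma returns_ge k : symmetric_seq D ->
  Lam ^+ (k + k) <= (count_mem 1%g (walks D (k + k)))%:R *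
                    \sum_(g <- undup (walks D k)) phi g ^+ 2.
Proof.
move=> sD; rewrite exprD -sum_walks_eigen -expr2; apply: le_trans (sum_sqr_le _ _) _.
rewrite -sum_walks_coincide //.
by under [in X in _ <= X]eq_bigr do under eq_bigr do rewrite mul1g.
Qed.
End PositiveEigenfunction.
End Sums.
End Walks.

(** * Growth rates *)

Section Growth.
Variable R : realType.

Lemma bernoulli_le (h : R) m : 0 <= h -> 1 + m%:R * h <= (1 + h) ^+ m.
Proof.
move=> h0; elim: m => [|m IH]; first by rewrite mul0r addr0 expr0.
rewrite exprS; apply: (@le_trans _ _ ((1 + h) * (1 + m%:R * h))); last first.
  by rewrite ler_wpM2l // addr_ge0.
have -> : (1 + h) * (1 + m%:R * h) = 1 + m.+1%:R * h + m%:R * h ^+ 2.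
  by rewrite -[m.+1%:R]natr1; ring.
by rewrite lerDl mulr_ge0 // sqr_ge0.
Qed.

Lemma exprn_mono (x y : R) n : 0 <= x -> x <= y -> x ^+ n <= y ^+ n.
Proof. by move=> x0 xy; apply: lerXn2r => //; rewrite nnegrE // (le_trans x0). Qed.

(** Otherwise, by Bernoulli's inequality, the exponent [m * d.+1] would make a quantity of
    order [m ^ d.+1] smaller than one of order [m ^ d]. *)
Lemma polynomial_growth (x y C : R) d : 0 <= x -> 0 <= y -> 0 <= C ->
  (forall k, x ^+ k <= C * k.+1%:R ^+ d * y ^+ k) -> x <= y.
Proof.
move=> x0 y0 C0 H; rewrite leNgt; apply/negP => yx.
have [yE|yn0] := eqVneq y 0.
  by have := H 1%N; rewrite yE !expr1 mulr0 => xle; rewrite yE ltNge xle in yx.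
have {y0} y0 : 0 < y by rewrite lt_neqAle eq_sym yn0.
pose h := x / y - 1; have h0 : 0 < h by rewrite subr_gt0 ltr_pdivlMr // mul1r.
have xE : x = (1 + h) * y by rewrite /h addrCA subrr addr0 divfK.
have {}H k : (1 + h) ^+ k <= C * k.+1%:R ^+ d.
  by have := H k; rewrite xE exprMn ler_pM2r // exprn_gt0.
pose B := C * d.+2%:R ^+ d / h ^+ d.+1.
have B0 : 0 <= B by rewrite /B !mulr_ge0 ?exprn_ge0 ?ler0n ?invr_ge0 ?exprn_ge0 // ltW.
pose m := (Num.bound B).+1.
have Bm : B < m%:R.
  by apply: lt_trans (archi_boundP B0) _; rewrite ltr_nat.
have m0 : 0 < m%:R :> R by rewrite ltr0n.
have : (m%:R * h) ^+ d.+1 <= C * d.+2%:R ^+ d * m%:R ^+ d.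
  have mh0 : 0 <= m%:R * h by rewrite mulr_ge0 // ltW.
  have h1 : 0 <= 1 + h by rewrite addr_ge0 // ltW.
  apply: (@le_trans _ _ ((1 + m%:R * h) ^+ d.+1)).
    by apply: exprn_mono => //; rewrite lerDr.
  apply: (@le_trans _ _ ((1 + h) ^+ (m * d.+1))).
    rewrite exprM; apply: exprn_mono; first by rewrite addr_ge0.
    by apply: bernoulli_le; rewrite ltW.
  apply: le_trans (H _) _; rewrite -mulrA ler_wpM2l // -exprMn.
  apply: exprn_mono; rewrite // -natrM ler_nat.
  by rewrite [leqRHS]mulSn mulnC -add1n leq_add2r.
have -> : (m%:R * h) ^+ d.+1 = m%:R * h ^+ d.+1 * m%:R ^+ d.
  by rewrite exprMn [m%:R ^+ d.+1]exprS mulrAC.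
by rewrite ler_pM2r ?exprn_gt0 // -ler_pdivlMr ?exprn_gt0 // -/B leNgt Bm.
Qed.
End Growth.

Section StabilizerReturns.
Local Open Scope group_scope.
Variables (R : realType) (G : groupType) (D : seq G) (Lam : R).
Variables (P : pred G) (B : G -> nat) (c : nat).
Hypotheses (P1 : P 1) (PM : forall g h, P g -> P h -> P (g * h)).
Hypotheses (B1 : B 1 = 0%N)
  (BM : forall g h, P g -> P h -> (B (g * h) <= B g + B h)%N).
Hypothesis card_B : forall L (t : seq G), uniq t ->
  (forall g, g \in t -> P g && (B g <= L)%N) -> (size t <= c * L.+1)%N.
Hypotheses (sD : symmetric_seq D) (Lam0 : (0 <= Lam)%R).
Hypothesis returns : forall k,
  (((count_mem 1%g (walks D k))%:R : R) <= Lam ^+ k)%R.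

Lemma size_walks K p : size (walks K p : seq G) = (size K ^ p)%N.
Proof. by elim: p => [//|p IH]; rewrite /= size_allpairs IH expnS. Qed.

Lemma sum_walks_sub (K : seq G) n p (F : G -> R) : (forall g, 0 <= F g)%R ->
  (forall F : G -> R, (forall g, 0 <= F g)%R ->
    \sum_(g <- K) F g <= \sum_(g <- walks D n) F g)%R ->
  (\sum_(g <- walks K p) F g <= \sum_(g <- walks D (p * n)) F g)%R.
Proof.
move=> F0 KD; elim: p F F0 => [|p IH] F F0; first by rewrite mul0n.
rewrite sum_walksS mulSn sum_walksD.
apply: (@le_trans _ _ (\sum_(d <- K) \sum_(h <- walks D (p * n)) F (d * h)%g)%R).
  by apply: ler_sum => d _; apply: (IH (fun g => F (d * g)%g)).
by apply: KD => g; apply: sumr_ge0.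
Qed.

(** Walks that end in [P] can be concatenated. If [J] bounds [B] on the end points in [P]
    of the walks of length [k + k], then [p] of them in a row end at a point of [P] with
    [B] at most [p * J]; there are linearly many such points in [p], and each is reached at
    most as often as the identity. The p-th power of the count is thus at most a linear
    function of [p] times [Lam ^+ (p * (k + k))]. A bound of [B] by the word length would
    not do: it may be exponential. *)
Lemma stabilizer_returns k : ((count P (walks D (k + k)))%:R <= Lam ^+ (k + k))%R.
Proof.
set n := (k + k)%N; pose K := [seq g <- walks D n | P g].
pose J := (\max_(g <- K) B g)%N.
have KP p : forall g, g \in walks K p -> P g && (B g <= p * J)%N.
  elim: p => [|p IH] g /=; first by rewrite inE => /eqP ->; rewrite P1 B1.
  move=> /allpairsP[[d h] /= [dK /IH /andP[Ph Bh] ->]].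
  have Pd : P d by move: dK; rewrite mem_filter => /andP[].
  rewrite PM //= (leq_trans (BM Pd Ph)) // mulSn leq_add //.
  by rewrite /J; exact: leq_bigmax_seq.
have sub (F : G -> R) : (forall g, 0 <= F g)%R ->
    (\sum_(g <- K) F g <= \sum_(g <- walks D n) F g)%R.
  move=> F0; rewrite /K big_filter [leRHS](bigID P) /= lerDl.
  exact: sumr_ge0.
have sK : size K = count P (walks D n) by rewrite size_filter.
apply: (@polynomial_growth R _ _ (c * J.+1)%:R 1) => //; first exact: exprn_ge0.
move=> p; rewrite -sK -[(_%:R ^+ p)%R]natrX -size_walks -sum1_size natr_sum sum_undup.
apply: (@le_trans _ _ (\sum_(y <- undup (walks K p)) Lam ^+ (n * p))%R).
  apply: ler_sum => y _; rewrite mulr1 -sum_eq_count.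
  have F0 g : (0 <= (y == g)%:R :> R)%R by rewrite ler0n.
  apply: le_trans (sum_walks_sub p F0 sub) _.
  rewrite sum_eq_count; apply: (@le_trans _ _ (count_mem 1%g (walks D (p * n)))%:R).
    by rewrite ler_nat mulnDr count_walks_le.
  by apply: le_trans (returns _) _; rewrite mulnC.
rewrite big_const_seq count_predT iter_addr_0 -[leLHS]mulr_natl -exprM.
rewrite ler_wpM2r ?exprn_ge0 // expr1 -natrM ler_nat.
apply: leq_trans (card_B (undup_uniq _) _) _.
  by move=> g; rewrite mem_undup; exact: KP.
by nia.
Qed.
End StabilizerReturns.

(** * Stabilizers of lines in the integer plane *)

Section LineStabilizer.
Variable v : 'rV[int]_2.
Hypothesis v0 : v != 0.
Implicit Types g h : GL2Z.
Local Notation "g `@ ( i , j )" := (GL2Z_mx g i j) (at level 2, format "g `@ ( i , j )").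

Lemma sum_I2 (T : nmodType) (F : 'I_2 -> T) : \sum_i F i = F 0 + F 1.
Proof.
by rewrite big_ord_recl big_ord1; congr (_ + F _); apply: val_inj.
Qed.

Lemma ord2P (P : 'I_2 -> Prop) : P 0 -> P 1 -> forall i, P i.
Proof.
move=> P0 P1 i; case: (unliftP 0 i) => [j ->|-> //].
by rewrite (_ : lift 0 j = 1) //; apply: val_inj; rewrite /= !ord1.
Qed.

Lemma GL2Z_mulE g h i j :
  GL2Z_mx (g * h)%g i j = g`@(i, 0) * h`@(0, j) + g`@(i, 1) * h`@(1, j).
Proof. by rewrite [LHS]mxE sum_I2. Qed.

Definition GL2Z_det g : int := g`@(0, 0) * g`@(1, 1) - g`@(0, 1) * g`@(1, 0).

Lemma GL2Z_detM g h : GL2Z_det (g * h)%g = GL2Z_det g * GL2Z_det h.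
Proof. by rewrite /GL2Z_det !GL2Z_mulE; ring. Qed.

Lemma GL2Z_det1 : GL2Z_det 1%g = 1.
Proof. by rewrite /GL2Z_det /= !mxE /=; ring. Qed.

Lemma GL2Z_detP g : GL2Z_det g = 1 \/ GL2Z_det g = -1.
Proof.
have := GL2Z_det1; rewrite -(mulgV g) GL2Z_detM => /(congr1 absz).
rewrite abszM /= => /eqP; rewrite muln_eq1 => /andP[/eqP]; lia.
Qed.

(** Both signs occur because the waves of frequencies [v] and [- v] are correlated. *)
Definition fixes_line g := (v *m GL2Z_mx g == v) || (v *m GL2Z_mx g == - v).

(** The image under [g] of [(- v 0 1, v 0 0)], the vector orthogonal to [v]. *)
Definition perp_im g j : int := v 0 0 * g`@(1, j) - v 0 1 * g`@(0, j).

(** The off-diagonal coefficient of [g] in the basis formed by [v] and its orthogonal,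
    scaled by the square of the length of [v] so as to be an integer. *)
Definition shear g : int := perp_im g 0 * v 0 0 + perp_im g 1 * v 0 1.

Definition fix_sign g : int := if v *m GL2Z_mx g == v then 1 else -1.

Lemma fixes_lineP g : fixes_line g -> forall j,
  v 0 0 * g`@(0, j) + v 0 1 * g`@(1, j) = fix_sign g * v 0 j.
Proof.
move=> fg j; have : (v *m GL2Z_mx g) 0 j = fix_sign g * v 0 j.
  move: fg; rewrite /fixes_line /fix_sign.
  by case: eqP => [-> _|_ /eqP ->]; rewrite ?mxE ?mul1r ?mulN1r.
by rewrite mxE sum_I2.
Qed.

Lemma fix_sign_sqr g : fix_sign g ^+ 2 = 1.
Proof. by rewrite /fix_sign; case: ifP. Qed.

Let N : int := v 0 0 ^+ 2 + v 0 1 ^+ 2.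

Lemma N_neq0 : N != 0.
Proof.
apply: contra v0; rewrite paddr_eq0 ?sqr_ge0 // !sqrf_eq0 => /andP[/eqP a0 /eqP a1].
by apply/eqP/matrixP => i j; rewrite ord1 mxE; elim/ord2P: j.
Qed.

Lemma perp_im_coord g : fixes_line g ->
  perp_im g 1 * v 0 0 - perp_im g 0 * v 0 1 = fix_sign g * GL2Z_det g * N.
Proof.
move=> fg; have e0 := fixes_lineP fg 0; have e1 := fixes_lineP fg 1.
have h : GL2Z_det g * N = (v 0 0 * g`@(0, 0) + v 0 1 * g`@(1, 0)) * perp_im g 1
    - (v 0 0 * g`@(0, 1) + v 0 1 * g`@(1, 1)) * perp_im g 0.
  by rewrite /GL2Z_det /N /perp_im; ring.
rewrite -mulrA h e0 e1 -[LHS]mul1r -(fix_sign_sqr g); ring.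
Qed.

(** The orthogonal decomposition of [perp_im g], multiplied by [N] to avoid fractions.
    The coefficient of the second vector is, up to [N], the product of two signs. *)
Lemma perp_imE g j : fixes_line g ->
  N * perp_im g j = shear g * v 0 j +
    fix_sign g * GL2Z_det g * N * (if j == 0 then - v 0 1 else v 0 0).
Proof.
move=> fg; rewrite -(perp_im_coord fg); elim/ord2P: j => /=; rewrite /shear /N; ring.
Qed.

Lemma shearM g h : fixes_line g -> fixes_line h ->
  shear (g * h)%g = fix_sign h * shear g + fix_sign g * GL2Z_det g * shear h.
Proof.
move=> fg fh; apply: (mulfI N_neq0).
have e0 := fixes_lineP fh 0; have e1 := fixes_lineP fh 1.
have p j : N * perp_im (g * h)%g j =
    shear g * (fix_sign h * v 0 j) + fix_sign g * GL2Z_det g * N * perp_im h j.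
  have -> : N * perp_im (g * h)%g j =
      (N * perp_im g 0) * h`@(0, j) + (N * perp_im g 1) * h`@(1, j).
    by rewrite /perp_im !GL2Z_mulE; ring.
  rewrite !perp_imE //= -(fixes_lineP fh) /perp_im; ring.
have -> : N * shear (g * h)%g =
    (N * perp_im (g * h)%g 0) * v 0 0 + (N * perp_im (g * h)%g 1) * v 0 1.
  by rewrite /shear; ring.
by rewrite !p /shear /N; ring.
Qed.

Lemma fixes_line1 : fixes_line 1%g.
Proof. by rewrite /fixes_line /= mulmx1 eqxx. Qed.

Lemma fixes_lineM g h : fixes_line g -> fixes_line h -> fixes_line (g * h)%g.
Proof.
rewrite /fixes_line => /orP[] /eqP gE /orP[] /eqP hE.
- by rewrite /= mulmxA gE hE eqxx.
- by rewrite /= mulmxA gE hE eqxx orbT.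
- by rewrite /= mulmxA gE mulNmx hE eqxx orbT.
- by rewrite /= mulmxA gE mulNmx hE opprK eqxx.
Qed.

Lemma absz_shear1 : `|shear 1%g|%N = 0%N.
Proof. by rewrite /shear /perp_im /= !mxE /=; lia. Qed.

Lemma absz_shearM g h : fixes_line g -> fixes_line h ->
  (`|shear (g * h)%g| <= `|shear g| + `|shear h|)%N.
Proof.
move=> fg fh; rewrite shearM //.
have := GL2Z_detP g; rewrite /fix_sign.
by case: ifP => _; case: ifP => _ [] ->; lia.
Qed.

(** [g] is determined by the images of [v] and of its orthogonal, and [perp_imE] recovers
    the second one from the shear and the two signs. *)
Lemma line_stabilizer_inj g h : fixes_line g -> fixes_line h ->
  (v *m GL2Z_mx g == v) = (v *m GL2Z_mx h == v) ->
  (GL2Z_det g == 1) = (GL2Z_det h == 1) -> shear g = shear h -> g = h.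
Proof.
move=> fg fh se de she.
have {}de : GL2Z_det g = GL2Z_det h.
  by move: de; case: (GL2Z_detP g) => ->; case: (GL2Z_detP h) => ->.
have {}se : fix_sign g = fix_sign h by rewrite /fix_sign se.
have p j : perp_im g j = perp_im h j.
  by apply: (mulfI N_neq0); rewrite !perp_imE // de se she.
have z j : v 0 0 * g`@(0, j) + v 0 1 * g`@(1, j) =
           v 0 0 * h`@(0, j) + v 0 1 * h`@(1, j).
  by rewrite !fixes_lineP // se.
have r0 j : N * (g`@(0, j)) = N * (h`@(0, j)).
  transitivity (v 0 0 * (v 0 0 * g`@(0, j) + v 0 1 * g`@(1, j)) - v 0 1 * perp_im g j).
    by rewrite /N /perp_im; ring.
  by rewrite z p /N /perp_im; ring.
have r1 j : N * (g`@(1, j)) = N * (h`@(1, j)).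
  transitivity (v 0 1 * (v 0 0 * g`@(0, j) + v 0 1 * g`@(1, j)) + v 0 0 * perp_im g j).
    by rewrite /N /perp_im; ring.
  by rewrite z p /N /perp_im; ring.
apply/val_inj/matrixP => i j; apply: (mulfI N_neq0).
by elim/ord2P: i.
Qed.

Lemma card_line_stabilizer L (t : seq GL2Z) : uniq t ->
  (forall g, g \in t -> fixes_line g && (`|shear g| <= L)%N) ->
  (size t <= 8 * L.+1)%N.
Proof.
move=> ut th.
(* the data that determine an element, by [line_stabilizer_inj] *)
pose code g : bool * bool * bool * 'I_L.+1 :=
  (v *m GL2Z_mx g == v, GL2Z_det g == 1, 0 <= shear g, inord `|shear g|%N).
have cu : uniq (map code t).
  rewrite map_inj_in_uniq // => g h /th /andP[fg lg] /th /andP[fh lh] [e1 e2 e3 e4].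
  apply: line_stabilizer_inj => //.
  move: e4 => /(congr1 val); rewrite /= !inordK ?ltnS // => e4.
  by move: e3 e4; lia.
rewrite -(size_map code) -(card_uniqP cu); apply: leq_trans (max_card _) _.
by rewrite !card_prod card_bool card_ord.
Qed.
End LineStabilizer.

(** * Waves on the torus *)

Section Waves.
Variable R : realType.
Local Notation T := (torus R).
Local Open Scope quotient_scope.
Implicit Types (v w : 'rV[int]_2) (u : 'cV[R]_2) (th : R) (x t : T) (g : GL2Z).

Definition pairing v u : R := (map_mx intr v *m u) 0 0.

Lemma pairingE v u : pairing v u = (v 0 0)%:~R * u 0 0 + (v 0 1)%:~R * u 1 0.
Proof. by rewrite /pairing mxE sum_I2 !mxE. Qed.

Lemma pairingDr v u1 u2 : pairing v (u1 + u2) = pairing v u1 + pairing v u2.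
Proof. by rewrite /pairing mulmxDr mxE. Qed.

Lemma pairingDl v w u : pairing (v + w) u = pairing v u + pairing w u.
Proof. by rewrite /pairing map_mxD mulmxDl mxE. Qed.

Lemma pairingNl v u : pairing (- v) u = - pairing v u.
Proof. by rewrite /pairing map_mxN mulNmx mxE. Qed.

Lemma pairing_act v g u :
  pairing v (map_mx intr (GL2Z_mx g) *m u) = pairing (v *m GL2Z_mx g) u.
Proof. by rewrite /pairing map_mxM mulmxA. Qed.

Lemma cosD2pi_int th (k : int) : cos (th + 2 * pi * k%:~R) = cos th.
Proof.
have H (n : nat) y : cos (y + 2 * pi * n%:R) = cos y :> R.
  by rewrite mulrAC -natrM mulr_natl mulrnA (periodicn (@cosD2pi R) n).
case: (intP k) => [|n|n]; first by rewrite mulr0 addr0.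
  by rewrite -pmulrn H.
by rewrite mulrNz -pmulrn -[LHS](H n.+1) mulrN subrK.
Qed.

Lemma torus_reprK x : \pi_T (repr x) = x.
Proof. exact: reprK. Qed.

Lemma torus_piD u1 u2 : \pi_T (u1 + u2) = \pi_T u1 + \pi_T u2 :> T.
Proof. exact: raddfD. Qed.

(** Phases make this real family stable under products and under translations. *)
Definition wave v th x : R := cos (2 * pi * pairing v (repr x) + th).

Lemma wave_pi v th u : wave v th (\pi_T u) = cos (2 * pi * pairing v u + th).
Proof.
have dZ : repr (\pi_T u) - u \in @Z2 R by apply/torus_pi_eq; exact: reprK.
have [m mE] : exists m : int, pairing v (repr (\pi_T u)) = pairing v u + m%:~R.
  have /mxOverP d := dZ; have /intrP[m0 m0E] := d 0 0; have /intrP[m1 m1E] := d 1 0.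
  exists (v 0 0 * m0 + v 0 1 * m1).
  rewrite -[in LHS](subrK u (repr _)) pairingDr addrC; congr (_ + _).
  by rewrite pairingE m0E m1E rmorphD !rmorphM.
by rewrite /wave mE mulrDr addrAC cosD2pi_int.
Qed.

(** The action moves frequencies by [v |-> v *m g]; averaging over the group becomes
    walking in the integer plane. *)
Lemma wave_act v th g x : wave v th (torus_act g x) = wave (v *m GL2Z_mx g) th x.
Proof. by rewrite /torus_act wave_pi pairing_act. Qed.

Lemma waveM v w a b x :
  wave v a x * wave w b x =
  2^-1 * wave (v + w) (a + b) x + 2^-1 * wave (v - w) (a - b) x.
Proof.
rewrite /wave !pairingDl pairingNl.
set p := pairing v _; set r := pairing w _.
have -> : 2 * pi * (p + r) + (a + b) = (2 * pi * p + a) + (2 * pi * r + b) by ring.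
have -> : 2 * pi * (p - r) + (a - b) = (2 * pi * p + a) - (2 * pi * r + b) by ring.
by move: (_ + a) (_ + b) => X Y; rewrite cosB cosD; field.
Qed.

Lemma wave_le1 v th x : `|wave v th x| <= 1.
Proof. exact: cos_max. Qed.

Lemma wave0 th x : wave 0 th x = cos th.
Proof. by rewrite /wave pairingE !mxE !mul0r addr0 mulr0 add0r. Qed.

Lemma linear_coord_continuous (V : normedModType R) (a b : V) :
  continuous (fun u : 'cV[R]_2 => u 0 0 *: a + u 1 0 *: b).
Proof.
have H (c : V) i : continuous (fun u : 'cV[R]_2 => u i 0 *: c).
  move=> u; have h : (fun w : 'cV[R]_2 => w i 0) w @[w --> u] --> u i 0.
    exact: coord_continuous.
  exact: (cvgZr_tmp h).
by move=> u; exact: (cvgD (H a 0 u) (H b 1 u)).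
Qed.

Lemma pairing_continuous v : continuous (pairing v : 'cV[R]_2 -> R).
Proof.
rewrite (_ : pairing v = fun u : 'cV[R]_2 =>
  u 0 0 *: ((v 0 0)%:~R : R^o) + u 1 0 *: ((v 0 1)%:~R : R^o)); last first.
  by apply/funext => u; rewrite pairingE /GRing.scale /= mulrC [X in _ + X]mulrC.
exact: linear_coord_continuous.
Qed.

Lemma wave_continuous v th : continuous (wave v th).
Proof.
apply/quotient_continuous.
rewrite (_ : _ \o _ = fun u : 'cV[R]_2 => cos (2 * pi * pairing v u + th)); last first.
  by apply/funext => u /=; rewrite wave_pi.
move=> u; apply: continuous_comp; last exact: continuous_cos.
exact: (cvgD (cvgMl_tmp (@pairing_continuous v u)) (cvg_cst th)).
Qed.

Lemma torus_open_measurable (A : set T) : open A -> measurable A.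
Proof. by move=> oA; apply: sub_sigma_algebra. Qed.

Lemma torus_continuous_measurable (f : T -> R) :
  continuous f -> measurable_fun setT f.
Proof.
move=> /continuousP cf; apply: (measurability _ (RGenOpens.measurableE R)).
move=> _ [_ [a [b ->] <-]]; rewrite setTI; apply: torus_open_measurable.
by apply: cf; exact: interval_open.
Qed.

Lemma wave_measurable v th : measurable_fun setT (wave v th).
Proof. apply: torus_continuous_measurable; exact: wave_continuous. Qed.

Lemma torus_map_measurable (f : T -> T) : continuous f -> measurable_fun setT f.
Proof.
move=> /continuousP cf; apply: (measurability _ (erefl _ : measurable = <<s @open T >>)).
move=> _ [A oA <-]; rewrite setTI; apply: torus_open_measurable; exact: cf.
Qed.

Lemma mulmx_continuous (A : 'M[R]_2) : continuous (mulmx A : 'cV[R]_2 -> 'cV[R]_2).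
Proof.
rewrite (_ : mulmx A = fun u : 'cV[R]_2 => u 0 0 *: col 0 A + u 1 0 *: col 1 A).
  exact: linear_coord_continuous.
apply/funext => u; apply/matrixP => i j; rewrite !mxE sum_I2 ord1.
by rewrite [X in X + _]mulrC [X in _ + X]mulrC.
Qed.

Lemma torus_act_measurable g : measurable_fun setT (@torus_act R g).
Proof.
apply: torus_map_measurable; apply/quotient_continuous.
rewrite (_ : _ \o _ = (\pi_T : _ -> T) \o mulmx (map_mx intr (GL2Z_mx g))); last first.
  by apply/funext => u /=; rewrite torus_act_pi.
move=> u; apply: continuous_comp; last exact: pi_continuous.
exact: mulmx_continuous.
Qed.

Lemma torus_translate_measurable t : measurable_fun setT (fun x : T => t + x).
Proof.
apply: torus_map_measurable; apply/quotient_continuous.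
rewrite (_ : _ \o _ = (\pi_T : _ -> T) \o (fun u => repr t + u)); last first.
  by apply/funext => u /=; rewrite torus_piD torus_reprK.
move=> u; apply: continuous_comp; last exact: pi_continuous.
have h : (fun w : 'cV[R]_2 => w) w @[w --> u] --> u by exact: cvg_id.
exact: (cvgD (cvg_cst (repr t : 'cV[R]_2)) h).
Qed.

End Waves.

(** * Bounded measurable functions and their means *)

Section BoundedMeasurable.
Context (d : measure_display) (T : measurableType d) (R : realType).
Variable P : probability T R.
Implicit Types (f g : T -> R) (c : R).

Definition bounded_measurable f :=
  measurable_fun setT f /\ exists M, forall x, `|f x| <= M.
Local Notation bm := bounded_measurable.

Definition mean f : R := \int[P]_x f x.
Local Notation E := mean.

Lemma bm_integrable f : bm f -> P.-integrable setT (EFin \o f).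
Proof.
move=> [mf [M fM]]; apply: measurable_bounded_integrable => //.
  by have := @probability_setT _ _ _ P => /= ->; rewrite ltry.
exists M; split; first exact: num_real.
by move=> y My x _; exact: le_trans (fM x) (ltW My).
Qed.

Lemma bm_cst c : bm (fun=> c).
Proof. by split; [exact: measurable_cst | exists `|c|]. Qed.

Lemma bmD f g : bm f -> bm g -> bm (fun x => f x + g x).
Proof.
move=> [mf [M fM]] [mg [N gN]]; split; first exact: measurable_funD.
by exists (M + N) => x; apply: le_trans (ler_normD _ _) _; apply: lerD.
Qed.

Lemma bmM f g : bm f -> bm g -> bm (fun x => f x * g x).
Proof.
move=> [mf [M fM]] [mg [N gN]]; split; first exact: measurable_funM.
by exists (M * N) => x; rewrite normrM ler_pM.
Qed.

Lemma bmZ c f : bm f -> bm (fun x => c * f x).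
Proof. by move=> bf; apply: bmM => //; exact: bm_cst. Qed.

Lemma bmB f g : bm f -> bm g -> bm (fun x => f x - g x).
Proof.
move=> bf bg; rewrite (_ : (fun x => _) = fun x => f x + (-1) * g x).
  by apply: bmD => //; exact: bmZ.
by apply/funext => x; rewrite mulN1r.
Qed.

Lemma bmX f n : bm f -> bm (fun x => f x ^+ n).
Proof.
move=> bf; elim: n => [|n IH]; first exact: bm_cst.
by under eq_fun do rewrite exprS; exact: bmM.
Qed.

Lemma bm_sum (I : Type) (s : seq I) (F : I -> T -> R) :
  (forall i, bm (F i)) -> bm (fun x => \sum_(i <- s) F i x).
Proof.
move=> bF; elim: s => [|i s IH].
  by under eq_fun do rewrite big_nil; exact: bm_cst.
by under eq_fun do rewrite big_cons; exact: bmD.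
Qed.

Lemma bm_comp f (phi : T -> T) : measurable_fun setT phi -> bm f -> bm (f \o phi).
Proof.
move=> mphi [mf [M fM]]; split; first exact: measurableT_comp.
by exists M => x /=.
Qed.

Lemma meanD f g : bm f -> bm g -> E (fun x => f x + g x) = E f + E g.
Proof. by move=> bf bg; apply: RintegralD => //; exact: bm_integrable. Qed.

Lemma meanB f g : bm f -> bm g -> E (fun x => f x - g x) = E f - E g.
Proof. by move=> bf bg; apply: RintegralB => //; exact: bm_integrable. Qed.

Lemma meanZ c f : bm f -> E (fun x => c * f x) = c * E f.
Proof. by move=> bf; apply: RintegralZl => //; exact: bm_integrable. Qed.

Lemma mean_cst c : E (fun=> c) = c.
Proof.
by rewrite /mean Rintegral_cst //; have := @probability_setT _ _ _ P => /= ->; rewrite mulr1.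
Qed.

Lemma mean_sum (I : Type) (s : seq I) (F : I -> T -> R) : (forall i, bm (F i)) ->
  E (fun x => \sum_(i <- s) F i x) = \sum_(i <- s) E (F i).
Proof.
move=> bF; elim: s => [|i s IH].
  by under eq_fun do rewrite big_nil; rewrite mean_cst big_nil.
under eq_fun do rewrite big_cons; rewrite big_cons meanD ?IH //.
exact: bm_sum.
Qed.

Lemma mean_ge0 f : (forall x, 0 <= f x) -> 0 <= E f.
Proof. by move=> f0; apply: Rintegral_ge0 => x _. Qed.

Lemma le_mean f g : bm f -> bm g -> (forall x, f x <= g x) -> E f <= E g.
Proof. by move=> bf bg fg; apply: le_Rintegral => //; exact: bm_integrable. Qed.

Lemma mean_sqr_ge f : bm f -> E f ^+ 2 <= E (fun x => f x ^+ 2).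
Proof.
move=> bf; have : 0 <= E (fun x => (f x - E f) ^+ 2) by apply: mean_ge0 => x; exact: sqr_ge0.
rewrite (_ : (fun x => _) = fun x => (f x ^+ 2 - (2 * E f) * f x) + E f ^+ 2); last first.
  by apply/funext => x; ring.
rewrite meanD ?mean_cst; [|by apply: bmB; [exact: bmX|exact: bmZ]|exact: bm_cst].
by rewrite meanB ?meanZ //; [nra|exact: bmX|exact: bmZ].
Qed.

Lemma mean_cauchy_schwarz f g : bm f -> bm g ->
  E (fun x => f x * g x) ^+ 2 <= E (fun x => f x ^+ 2) * E (fun x => g x ^+ 2).
Proof.
move=> bf bg; set A := E _; set B := E _; set C := E _.
have CE t : 2 * t * A <= B + t ^+ 2 * C.
  have : 0 <= E (fun x => (f x - t * g x) ^+ 2) by apply: mean_ge0 => x; exact: sqr_ge0.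
  rewrite (_ : (fun x => _) =
      fun x => (f x ^+ 2 - (2 * t) * (f x * g x)) + t ^+ 2 * g x ^+ 2); last first.
    by apply/funext => x; ring.
  have bfg := bmM bf bg; have bf2 := bmX 2 bf; have bg2 := bmX 2 bg.
  rewrite meanD; [|by apply: bmB => //; exact: bmZ|exact: bmZ].
  rewrite meanB //; last exact: bmZ.
  by rewrite !meanZ //; rewrite -/A -/B -/C; lra.
have B0 : 0 <= B by apply: mean_ge0 => x; exact: sqr_ge0.
have C0 : 0 <= C by apply: mean_ge0 => x; exact: sqr_ge0.
exact: sqr_le_of_quadratic.
Qed.

Lemma bounded_convergence (f_ : nat -> T -> R) f (M : R) :
  (forall n, measurable_fun setT (f_ n)) -> (forall n x, `|f_ n x| <= M) ->
  (forall x, f_ ^~ x @ \oo --> f x) ->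
  bm f /\ (E (f_ n) @[n --> \oo] --> E f).
Proof.
move=> mf fM cvf.
have mf' : measurable_fun setT f.
  by apply: (measurable_fun_cvg mf) => x _; exact: cvf.
have fM' x : `|f x| <= M.
  have h : `|f_ n x| @[n --> \oo] --> `|f x| by apply: cvg_norm; exact: cvf.
  rewrite -(cvg_lim _ h) //; apply: limr_le; first by apply/cvg_ex; eexists; exact: h.
  by apply: nearW => n; exact: fM.
have bf : bm f by split => //; exists M.
split => //.
have [|||||_ _ h] := @dominated_convergence _ _ _ P setT measurableT
  (fun n x => (f_ n x)%:E) (fun x => (f x)%:E) (fun=> M%:E).
- by move=> n; exact/measurable_EFinP.
- exact/measurable_EFinP.
- by apply: aeW => x _; apply/fine_cvgP; split; [exact: nearW | exact: cvf].
- exact: (bm_integrable (bm_cst M)).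
- by apply: aeW => x n _; rewrite lee_fin.
have h' : (\int[P]_x (f_ n x)%:E)%E @[n --> \oo] --> (E f)%:E.
  rewrite /mean /Rintegral fineK; first exact: h.
  by apply: integrable_fin_num => //; exact: (bm_integrable bf).
exact: (fine_cvg h').
Qed.
End BoundedMeasurable.

(** * Haar means of waves *)

Section HaarMean.
Variable R : realType.
Local Notation T := (torus R).
Local Open Scope quotient_scope.
Variable nu : probability T R.
Hypothesis haar : normalized_haar nu.
Implicit Types (v w : 'rV[int]_2) (u : 'cV[R]_2) (th : R) (x t : T) (g h : GL2Z).
Local Notation bm := bounded_measurable.
Local Notation E := (mean nu).

Lemma mean_translate (f : T -> R) t : bm f -> E (fun x => f (t + x)) = E f.
Proof.
move=> bf; rewrite /mean /Rintegral; congr fine.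
pose phi x : T := t + x.
have mphi : measurable_fun setT phi by exact: torus_translate_measurable.
have bft : bm (f \o phi) by exact: bm_comp.
have -> : (\int[nu]_x (f x)%:E)%E = (\int[pushforward nu phi]_x (f x)%:E)%E.
  apply: eq_measure_integral => A mA _; rewrite /pushforward /=.
  rewrite -(haar (- t) mA); congr (nu _).
  apply/seteqP; split => [x [y Ay <-]|x Ax] /=; first by rewrite /phi addNKr.
  by exists (phi x) => //; rewrite /phi addKr.
rewrite integral_pushforward //.
- by apply/measurable_EFinP; case: bf.
- exact: (bm_integrable nu bft).
Qed.

Lemma bm_wave v th : bm (wave v th : T -> R).
Proof. by split; [exact: wave_measurable | exists 1; exact: wave_le1]. Qed.

Lemma wave_translate_pi v th u x :
  wave v th (\pi_T u + x) = wave v (2 * pi * pairing v u + th) x.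
Proof.
rewrite -{1}[x]torus_reprK -torus_piD wave_pi pairingDr /wave.
by congr cos; ring.
Qed.

(** Translation by such a [u] changes the sign of the waves of frequency [v]. *)
Lemma half_period v : v != 0 -> exists u : 'cV[R]_2, pairing v u = 2^-1.
Proof.
move=> v0; pose N : R := ((v 0 0 ^+ 2 + v 0 1 ^+ 2)%:~R).
have N0 : N != 0 by rewrite /N intr_eq0; exact: N_neq0.
exists (\col_j ((v 0 j)%:~R / (2 * N))); rewrite pairingE !mxE.
have NE : N = (v 0 0)%:~R ^+ 2 + (v 0 1)%:~R ^+ 2 by rewrite /N rmorphD !rmorphXn.
by rewrite !mulrA -mulrDl -!expr2 -NE; clearbody N; field.
Qed.

Lemma mean_wave v th : E (wave v th) = if v == 0 then cos th else 0.
Proof.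
case: eqVneq => [->|v0].
  by rewrite (_ : wave 0 th = fun=> cos th) ?mean_cst //; apply/funext => x; rewrite wave0.
have [u hu] := half_period v0.
have := mean_translate (\pi_T u) (bm_wave v th).
rewrite (_ : (fun x => _) = fun x => (-1) * wave v th x); last first.
  apply/funext => x; rewrite wave_translate_pi hu /wave mulN1r -cosDpi; congr cos.
  by field.
rewrite meanZ; last exact: bm_wave.
by lra.
Qed.

Lemma mean_waveM v w a b : E (fun x => wave v a x * wave w b x) =
  2^-1 * (if v + w == 0 then cos (a + b) else 0) +
  2^-1 * (if v - w == 0 then cos (a - b) else 0).
Proof.
under eq_fun do rewrite waveM.
rewrite meanD ?meanZ ?mean_wave //; do ?[exact: bm_wave]; apply: bmZ; exact: bm_wave.
Qed.

Lemma row_mul_eq0 v g : (v *m GL2Z_mx g == 0) = (v == 0).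
Proof.
apply/eqP/eqP => [h|->]; last by rewrite mul0mx.
by rewrite -[v](mulmxK (valP g)) [v *m _]h mul0mx.
Qed.

(** The two frequencies are equal or opposite before the action if and only if they are
    so after it. *)
Lemma mean_waveM_act v w a b h :
  E (fun x => wave (v *m GL2Z_mx h) a x * wave (w *m GL2Z_mx h) b x) =
  E (fun x => wave v a x * wave w b x).
Proof. by rewrite !mean_waveM -mulmxDl -mulmxBl !row_mul_eq0. Qed.

(** Only the frequencies [v] and [- v] correlate with [wave v th]. *)
Lemma mean_wave_line v th g :
  E (fun x => wave (v *m GL2Z_mx g) th x * wave v th x) <= (fixes_line v g)%:R.
Proof.
rewrite mean_waveM /fixes_line addr_eq0 subr_eq0.
have := cos_le1 (th + th); have := cos_le1 (th - th).
by case: eqP; case: eqP => //= _ _; lra.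
Qed.

Definition trig (p : seq (R * 'rV[int]_2 * R)) x :=
  \sum_(c <- p) c.1.1 * wave c.1.2 c.2 x.

Lemma bm_trig p : bm (trig p).
Proof. by apply: bm_sum => c; apply: bmZ; exact: bm_wave. Qed.

(** The k-th power of the sum over [D], applied to a trigonometric polynomial. *)
Definition walk_sum D p k x := \sum_(g <- walks D k) trig p (torus_act g x).

Lemma bm_act (f : T -> R) g : bm f -> bm (fun x => f (torus_act g x)).
Proof. by move=> bf; apply: (bm_comp (phi := torus_act g)) => //; exact: torus_act_measurable. Qed.

Lemma bm_walk_sum D p k : bm (walk_sum D p k).
Proof. by apply: bm_sum => g; apply: bm_act; exact: bm_trig. Qed.

Lemma torus_actM g h x : torus_act g (torus_act h x) = torus_act (g * h)%g x.
Proof.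
by rewrite -[x]torus_reprK !torus_act_pi mulmxA -map_mxM.
Qed.

Lemma walk_sumS D p k x :
  walk_sum D p k.+1 x = \sum_(d <- D) walk_sum D p k (torus_act d x).
Proof.
rewrite /walk_sum sum_walksSr exchange_big /=; apply: eq_bigr => d _.
by apply: eq_bigr => g _; rewrite torus_actM.
Qed.

Lemma torus_act1 x : torus_act 1%g x = x.
Proof.
by rewrite -[x]torus_reprK torus_act_pi map_mx1 mul1mx.
Qed.

Lemma walk_sum0 D p x : walk_sum D p 0 x = trig p x.
Proof. by rewrite /walk_sum /= big_seq1 torus_act1. Qed.

Definition correlation p g : R := \sum_(c <- p) \sum_(e <- p)
  c.1.1 * e.1.1 * E (fun x => wave (c.1.2 *m GL2Z_mx g) c.2 x * wave e.1.2 e.2 x).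

Lemma mean_trig_act p g h :
  E (fun x => trig p (torus_act g x) * trig p (torus_act h x)) =
  correlation p (g * h^-1)%g.
Proof.
rewrite /correlation.
under eq_fun => x.
  rewrite /trig big_distrlr /=.
  under eq_bigr => c _ do under eq_bigr => e _ do rewrite !wave_act mulrACA.
  over.
rewrite mean_sum; last first.
  by move=> c; apply: bm_sum => e; apply: bmZ; apply: bmM; exact: bm_wave.
apply: eq_bigr => c _; rewrite mean_sum; last first.
  by move=> e; apply: bmZ; apply: bmM; exact: bm_wave.
apply: eq_bigr => e _; rewrite meanZ; last by apply: bmM; exact: bm_wave.
congr (_ * _); rewrite -[RHS](mean_waveM_act _ _ _ _ h).
congr mean; apply/funext => x; congr (wave _ _ _ * _).
by rewrite -mulmxA -[_ *m GL2Z_mx h]/(GL2Z_mx (g * h^-1 * h)%g) mulgVK.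
Qed.

(** Only [k + l] matters: the sum over [D] is a symmetric operator. Cauchy-Schwarz then
    makes the norms of its powers log-convex. *)
Lemma mean_walk_sumM D p k l : symmetric_seq D ->
  E (fun x => walk_sum D p k x * walk_sum D p l x) =
  \sum_(g <- walks D (k + l)) correlation p g.
Proof.
move=> sD; rewrite sum_walksD.
under eq_fun do rewrite /walk_sum big_distrlr /=.
have bm1 g h : bm (fun x => trig p (torus_act g x) * trig p (torus_act h x)).
  by apply: bmM; apply: bm_act; exact: bm_trig.
rewrite mean_sum; last by move=> g; apply: bm_sum => h; exact: bm1.
apply: eq_bigr => g _; rewrite mean_sum; last exact: bm1.
rewrite -(sum_walksV _ (fun h => correlation p (g * h)%g) sD).
by apply: eq_bigr => h _; exact: mean_trig_act.
Qed.
End HaarMean.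

(** * Norm bounds on trigonometric polynomials *)

Section LogConvex.
Variable R : realType.

(** The ratios of consecutive terms increase, so that the first of them is at most the
    exponential rate of the sequence. *)
Lemma log_convex_contraction (a : nat -> R) (K L : R) : 0 <= K -> 0 <= L ->
  (forall k, 0 <= a k) -> (forall k, a k.+1 ^+ 2 <= a k * a k.+2) ->
  (forall k, a k <= K * L ^+ k) -> a 1%N <= L * a 0%N.
Proof.
move=> K0 L0 a0 conv bound.
have step k : a k * a 1%N <= a k.+1 * a 0%N.
  elim: k => [|k IH]; first by rewrite mulrC.
  have [z|nz] := eqVneq (a k.+1) 0; first by rewrite z mul0r mulr_ge0.
  have pos : 0 < a k.+1 by rewrite lt_neqAle eq_sym nz a0.
  have ck := conv k.
  have pk : 0 < a k.
    rewrite lt_neqAle a0 andbT eq_sym; apply/eqP => z.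
    by move: ck; rewrite z mul0r leNgt exprn_gt0.
  rewrite -(ler_pM2l pk).
  apply: (@le_trans _ _ (a k.+1 ^+ 2 * a 0%N)).
    by rewrite expr2 -mulrA mulrCA ler_wpM2l.
  by rewrite mulrA ler_wpM2r.
have pw k : a 1%N ^+ k.+1 <= a k.+1 * a 0%N ^+ k.
  elim: k => [|k IH]; first by rewrite expr1 expr0 mulr1.
  rewrite exprSr; apply: (@le_trans _ _ (a k.+1 * a 0%N ^+ k * a 1%N)).
    by rewrite ler_wpM2r.
  by rewrite mulrAC exprS [leRHS]mulrA ler_wpM2r // exprn_ge0.
have [z|nz] := eqVneq (a 0%N) 0.
  by have := conv 0%N; rewrite z mul0r mulr0; nra.
have pos : 0 < a 0%N by rewrite lt_neqAle eq_sym nz a0.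
apply: (@polynomial_growth R _ _ (K / a 0%N + 1) 0) => //.
- by rewrite mulr_ge0.
- by rewrite addr_ge0 // divr_ge0.
move=> [|k]; first by rewrite !expr0 !mulr1 lerDr divr_ge0.
rewrite expr0 mulr1 exprMn mulrDl mul1r.
apply: (@le_trans _ _ (K / a 0%N * (L ^+ k.+1 * a 0%N ^+ k.+1))); last first.
  by rewrite lerDl mulr_ge0 // exprn_ge0.
apply: le_trans (pw k) _; rewrite [a 0%N ^+ k.+1]exprS.
have -> : K / a 0%N * (L ^+ k.+1 * (a 0%N * a 0%N ^+ k)) = K * L ^+ k.+1 * a 0%N ^+ k.
  by field.
by rewrite ler_wpM2r // exprn_ge0.
Qed.

Lemma sqr_sum_le (I : Type) (s : seq I) (F : I -> R) :
  (\sum_(i <- s) F i) ^+ 2 <= (size s)%:R * \sum_(i <- s) F i ^+ 2.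
Proof.
rewrite expr2 big_distrlr /=.
apply: (@le_trans _ _ (\sum_(i <- s) \sum_(j <- s) (2^-1 * F i ^+ 2 + 2^-1 * F j ^+ 2))).
  apply: ler_sum => i _; apply: ler_sum => j _.
  by have := sqr_ge0 (F i - F j); nra.
set S := \sum_(i <- s) F i ^+ 2; set n : R := (size s)%:R.
have const x : \sum_(i <- s) x = n * x.
  by rewrite big_const_seq count_predT iter_addr_0 mulr_natl.
have inner i : \sum_(j <- s) (2^-1 * F i ^+ 2 + 2^-1 * F j ^+ 2) =
    n * 2^-1 * F i ^+ 2 + 2^-1 * S.
  by rewrite big_split /= const -mulr_sumr mulrA.
under eq_bigr do rewrite inner.
by rewrite big_split /= const -mulr_sumr -/S; lra.
Qed.
End LogConvex.

Section TrigContraction.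
Variable R : realType.
Local Notation T := (torus R).
Variable nu : probability T R.
Hypothesis haar : normalized_haar nu.
Variables (D : seq GL2Z) (Lam C : R).
Hypotheses (sD : symmetric_seq D) (Lam0 : 0 <= Lam) (C0 : 0 <= C).
Hypothesis returns_upper : forall k,
  (count_mem 1%g (walks D k))%:R <= Lam ^+ k.
Hypothesis returns_lower : forall k,
  Lam ^+ (k + k) <= (count_mem 1%g (walks D (k + k)))%:R * (C * k.+1%:R ^+ 3).
Local Notation bm := bounded_measurable.
Local Notation E := (mean nu).
Local Notation W := (walk_sum D).
Implicit Types (p : seq (R * 'rV[int]_2 * R)) (v : 'rV[int]_2).

Lemma line_returns v k : v != 0 ->
  (count (fixes_line v) (walks D (k + k)))%:R <= Lam ^+ (k + k).
Proof.
move=> v0; apply: (@stabilizer_returns R _ D Lam _ (fun g => `|shear v g|%N) 8) => //.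
- exact: fixes_line1.
- by move=> g h; exact: fixes_lineM.
- exact: absz_shear1.
- by move=> g h; exact: absz_shearM.
- by move=> L t; exact: card_line_stabilizer.
Qed.

(** The second moment of the k-th power at one wave counts the walks of length [k + k]
    that stabilize its line of frequencies. *)
Lemma mean_walk_wave c k : c.1.2 != 0 ->
  E (fun x => W [:: c] k x ^+ 2) <= c.1.1 ^+ 2 * Lam ^+ (k + k).
Proof.
move=> v0; under eq_fun do rewrite expr2.
rewrite mean_walk_sumM //.
apply: (@le_trans _ _ (c.1.1 ^+ 2 * (count (fixes_line c.1.2) (walks D (k + k)))%:R)).
  rewrite -sum1_count natr_sum [X in _ <= _ * X]big_mkcond mulr_sumr /=; apply: ler_sum => g _.
  rewrite /correlation !big_seq1 -expr2 ler_wpM2l ?sqr_ge0 //.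
  by have := mean_wave_line haar c.1.2 c.2 g; case: (fixes_line _ g).
by rewrite ler_wpM2l ?sqr_ge0 // line_returns.
Qed.

Lemma walk_sum_waves p k x : W p k x = \sum_(c <- p) W [:: c] k x.
Proof.
rewrite /walk_sum exchange_big /=; apply: eq_bigr => g _.
by rewrite /trig; apply: eq_bigr => c _; rewrite big_seq1.
Qed.

Lemma mean_walk_le p k : (forall c, c \in p -> c.1.2 != 0) ->
  E (fun x => W p k x ^+ 2) <=
  ((size p)%:R * \sum_(c <- p) c.1.1 ^+ 2) * (Lam ^+ 2) ^+ k.
Proof.
move=> p0.
have bW c : bm (fun x => W [:: c] k x ^+ 2) by apply: bmX; exact: bm_walk_sum.
apply: (@le_trans _ _ (E (fun x => (size p)%:R * \sum_(c <- p) W [:: c] k x ^+ 2))).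
  apply: le_mean => [||x]; first by apply: bmX; exact: bm_walk_sum.
    by apply: bmZ; apply: bm_sum.
  by rewrite walk_sum_waves sqr_sum_le.
rewrite meanZ; last exact: bm_sum.
rewrite mean_sum // -mulrA ler_wpM2l // mulr_suml big_seq [leRHS]big_seq.
apply: ler_sum => c /p0 v0; rewrite -exprM mul2n -addnn.
exact: mean_walk_wave.
Qed.

Lemma trig_contraction p : (forall c, c \in p -> c.1.2 != 0) ->
  E (fun x => W p 1 x ^+ 2) <= Lam ^+ 2 * E (fun x => trig p x ^+ 2).
Proof.
move=> p0.
have -> : (fun x => trig p x ^+ 2) = (fun x => W p 0 x ^+ 2).
  by apply/funext => x; rewrite walk_sum0.
apply: (log_convex_contraction (a := fun k => E (fun x => W p k x ^+ 2)) (K := (size p)%:R * \sum_(c <- p) c.1.1 ^+ 2)).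
- by rewrite mulr_ge0 // sumr_ge0 // => c _; exact: sqr_ge0.
- exact: sqr_ge0.
- by move=> k; apply: mean_ge0 => x; exact: sqr_ge0.
- move=> k; apply: le_trans (mean_cauchy_schwarz nu (bm_walk_sum D p k) (bm_walk_sum D p k.+2)).
  rewrite (_ : mean _ _ = E (fun x => W p k x * W p k.+2 x)) //.
  under eq_fun do rewrite expr2.
  by rewrite !mean_walk_sumM // !addnS !addSn.
- by move=> k; exact: mean_walk_le.
Qed.

Lemma mean_trig p : E (trig p) = \sum_(c <- p | c.1.2 == 0) c.1.1 * cos c.2.
Proof.
rewrite /trig mean_sum; last by move=> c; apply: bmZ; exact: bm_wave.
rewrite [RHS]big_mkcond /=; apply: eq_bigr => c _; rewrite meanZ; last exact: bm_wave.
by rewrite mean_wave //; case: ifP => _ //; rewrite mulr0.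
Qed.

Lemma trig_split p x :
  trig p x = E (trig p) + trig [seq c <- p | c.1.2 != 0] x.
Proof.
rewrite mean_trig /trig big_filter (bigID (fun c => c.1.2 == 0)) /=; congr (_ + _).
by apply: eq_bigr => c /eqP ->; rewrite wave0.
Qed.

(** The average reproduces the constant term, and the rest has mean zero: the bound of
    [trig_contraction] applies to it. *)
Theorem trig_deviation p : (0 < size D)%N ->
  E (fun x => ((size D)%:R^-1 * W p 1 x - E (trig p)) ^+ 2) <=
  (Lam / (size D)%:R) ^+ 2 * E (fun x => trig p x ^+ 2).
Proof.
move=> D0; set S : R := (size D)%:R.
have S0 : S != 0 by rewrite pnatr_eq0 -lt0n.
set c := E (trig p); pose p0 := [seq c <- p | c.1.2 != 0].
have p0P e : e \in p0 -> e.1.2 != 0 by rewrite mem_filter => /andP[].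
have -> : (fun x => (S^-1 * W p 1 x - c) ^+ 2) = (fun x => S^-1 ^+ 2 * W p0 1 x ^+ 2).
  apply/funext => x; rewrite -exprMn; congr (_ ^+ 2).
  rewrite !walk_sumS; under eq_bigr do rewrite walk_sum0 trig_split.
  under [in RHS]eq_bigr do rewrite walk_sum0.
  rewrite big_split /= big_const_seq count_predT iter_addr_0 -mulr_natl -/S -/c mulrDr.
  by rewrite mulKf // addrAC subrr add0r.
have bW0 := bm_walk_sum D p0 1; have bp0 := bm_trig p0.
rewrite meanZ; last exact: bmX.
have -> : (fun x => trig p x ^+ 2) =
    (fun x => (c ^+ 2 + 2 * c * trig p0 x) + trig p0 x ^+ 2).
  by apply/funext => x; rewrite trig_split -/c -/p0; ring.
have m0 : E (trig p0) = 0.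
  by rewrite mean_trig big_seq_cond big1 // => e /andP[/p0P /negPf ->].
rewrite meanD; [|by apply: bmD; [exact: bm_cst|exact: bmZ]|exact: bmX].
rewrite meanD; [|exact: bm_cst|exact: bmZ].
rewrite meanZ // m0 mulr0 addr0 mean_cst.
rewrite expr_div_n [leRHS]mulrAC [leLHS]mulrC -exprVn ler_wpM2r ?sqr_ge0 //.
apply: le_trans (trig_contraction p0P) _.
by rewrite ler_wpM2l ?sqr_ge0 // lerDr sqr_ge0.
Qed.

Lemma walk_sum_trig v k : exists2 p, (v != 0 -> forall c, c \in p -> c.1.2 != 0) &
  trig p =1 W [:: (1 : R, v, 0 : R)] k /\ W p 1 =1 W [:: (1 : R, v, 0 : R)] k.+1.
Proof.
pose p := [seq (1 : R, v *m GL2Z_mx g, 0 : R) | g <- walks D k].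
have pE : trig p =1 W [:: (1 : R, v, 0 : R)] k.
  move=> x; rewrite /trig big_map /walk_sum; apply: eq_bigr => g _.
  by rewrite /trig big_seq1 wave_act.
exists p; first by move=> v0 c /mapP[g _ ->] /=; rewrite row_mul_eq0.
split=> // x; rewrite !walk_sumS; apply: eq_bigr => d _.
by rewrite walk_sum0 pE.
Qed.

(** Whatever the stabilizer of [v], it contains the identity, and no term is negative. *)
Lemma mean_walk_cos_ge v k :
  2^-1 * (count_mem 1%g (walks D (k + k)))%:R <=
  E (fun x => W [:: (1 : R, v, 0 : R)] k x ^+ 2).
Proof.
under eq_fun do rewrite expr2.
rewrite mean_walk_sumM // -sum1_count natr_sum [X in _ * X <= _]big_mkcond mulr_sumr /=.
apply: ler_sum => g _; rewrite /correlation !big_seq1 /= !mul1r mean_waveM //.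
rewrite addr0 subr0 cos0; case: eqP => [->|_].
  by rewrite mulmx1 subrr eqxx mulr1 lerDr; case: ifP => _; rewrite ?mulr1 ?mulr0.
by rewrite mulr0 addr_ge0 // mulr_ge0 //; case: ifP.
Qed.

(** A bound [M] on one step gives [M ^+ k] on [k] steps, against at least half the number
    of returns; the polynomial factor in [returns_lower] disappears in the limit. *)
Theorem trig_norm_ge (M : R) : 0 <= M ->
  (forall p, (forall c, c \in p -> c.1.2 != 0) ->
    E (fun x => W p 1 x ^+ 2) <= M * E (fun x => trig p x ^+ 2)) ->
  Lam ^+ 2 <= M.
Proof.
move=> M0 H; pose v : 'rV[int]_2 := const_mx 1.
have v0 : v != 0.
  by apply/eqP => /matrixP /(_ 0 0); rewrite !mxE.
pose a k := E (fun x => W [:: (1 : R, v, 0 : R)] k x ^+ 2).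
have aS k : a k.+1 <= M * a k.
  have [p p0 [pE WE]] := walk_sum_trig v k.
  have := H p (p0 v0); rewrite /a.
  by under eq_fun do rewrite WE; under [in X in _ <= X -> _]eq_fun do rewrite pE.
have a0 : a 0%N <= 1.
  rewrite -(@mean_cst _ _ _ nu 1); apply: le_mean; [|exact: bm_cst|].
    by apply: bmX; exact: bm_walk_sum.
  move=> x; rewrite walk_sum0 /trig big_seq1 mul1r.
  by rewrite -[leLHS]ger0_norm ?sqr_ge0 // normrX expr_le1 // wave_le1.
have ak k : a k <= M ^+ k.
  elim: k => [|k IH]; first by rewrite expr0.
  by apply: le_trans (aS k) _; rewrite exprS ler_wpM2l.
apply: (@polynomial_growth R _ _ (2 * C) 3) => //; first exact: sqr_ge0.
  by rewrite mulr_ge0.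
move=> k; rewrite -exprM mul2n -addnn.
apply: le_trans (returns_lower k) _.
have := le_trans (mean_walk_cos_ge v k) (ak k).
have : 0 <= C * k.+1%:R ^+ 3 by rewrite mulr_ge0 // exprn_ge0.
rewrite -[2 * C * _]mulrA; nra.
Qed.
End TrigContraction.

(** * Threshold functions *)

Section Threshold.
Variable R : realType.
Implicit Types (y z t : R) (n m K : nat).

Lemma bernoulli_sub t m : 0 <= t <= 1 -> 1 - m%:R * t <= (1 - t) ^+ m.
Proof.
move=> /andP[t0 t1]; elim: m => [|m IH]; first by rewrite mul0r subr0 expr0.
rewrite exprS; apply: (@le_trans _ _ ((1 - t) * (1 - m%:R * t))); last first.
  by rewrite ler_wpM2l // subr_ge0.
rewrite -[m.+1%:R]natr1; have : 0 <= m%:R * t ^+ 2 by rewrite mulr_ge0 // sqr_ge0.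
by lra.
Qed.

Lemma expr_sub_le t m : 0 <= t <= 1 -> (1 - t) ^+ m * (1 + m%:R * t) <= 1.
Proof.
move=> /andP[t0 t1]; apply: (@le_trans _ _ ((1 - t) ^+ m * (1 + t) ^+ m)).
  by rewrite ler_wpM2l ?exprn_ge0 ?subr_ge0 // bernoulli_le.
rewrite -exprMn exprn_ile1 //.
  by rewrite mulr_ge0 ?subr_ge0 ?addr_ge0.
by have := sqr_ge0 t; lra.
Qed.

Lemma expn_gap z e n : 0 <= z <= 1 -> 0 <= e ->
  z ^+ n + n%:R * z ^+ n * e <= (z + e) ^+ n.
Proof.
move=> /andP[z0 z1] e0; elim: n => [|n IH]; first by rewrite !expr0 mul0r mul0r addr0.
rewrite [leRHS]exprS.
apply: (@le_trans _ _ ((z + e) * (z ^+ n + n%:R * z ^+ n * e))); last first.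
  by rewrite ler_wpM2l // addr_ge0.
rewrite -[n.+1%:R]natr1 !exprS; set Z := z ^+ n.
have Z0 : 0 <= Z by rewrite exprn_ge0.
have h1 : z * Z * e <= Z * e by rewrite ler_wpM2r // ler_piMl.
have h2 : 0 <= n%:R * Z * e ^+ 2 by rewrite !mulr_ge0 // sqr_ge0.
by lra.
Qed.

Lemma cvg_mul_expr z : 0 <= z < 1 -> n%:R * z ^+ n @[n --> \oo] --> (0 : R).
Proof.
move=> /andP[z0 z1]; pose e := (1 - z) / 2; have e0 : 0 < e by rewrite /e; lra.
apply: (@squeeze_cvgr _ _ _ _ (fun=> 0) (fun n => e^-1 * (z + e) ^+ n)).
- apply: nearW => n; rewrite mulr_ge0 ?exprn_ge0 //=.
  rewrite ler_pdivlMl // mulrC; apply: le_trans (expn_gap n _ (ltW e0)); last first.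
    by rewrite z0 ltW.
  by rewrite lerDr exprn_ge0.
- exact: cvg_cst.
- rewrite -[X in _ --> X](mulr0 e^-1); apply: cvgMl_tmp; apply: cvg_expr.
  by rewrite ger0_norm /e; lra.
Qed.

(** Bernoulli's inequality on both sides of the threshold: below it, [n * K ^ n * y ^+ n]
    tends to 0; above it, [n * K ^ n] times [y ^+ n] is at least [n]. The factor [n] in the
    exponent is what decides the value at [y = K%:R^-1]. *)
Lemma cvg_threshold y K : (0 < K)%N -> 0 <= y <= 1 ->
  (1 - y ^+ n) ^+ (n * K ^ n) @[n --> \oo] --> ((y < K%:R^-1)%R%:R : R).
Proof.
move=> K0 /andP[y0 y1].
have yn n : 0 <= y ^+ n <= 1 by rewrite exprn_ge0 // exprn_ile1.
have K0' : 0 < K%:R :> R by rewrite ltr0n.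
case: ltP => h.
  apply: (@squeeze_cvgr _ _ _ _ (fun n => 1 - n%:R * (K%:R * y) ^+ n) (fun=> 1)).
  - apply: nearW => n; apply/andP; split.
      apply: le_trans (bernoulli_sub _ (yn n)).
      by rewrite natrM natrX exprMn mulrA.
    have /andP[a b] := yn n.
    by rewrite exprn_ile1 // ?subr_ge0 // gerBl.
  - have z01 : 0 <= K%:R * y < 1.
      rewrite mulr_ge0 //=.
      by rewrite -(ltr_pM2l K0') divff ?gt_eqF // in h.
    rewrite -[X in _ --> X](subr0 1).
    exact: (cvgB (cvg_cst (1 : R)) (cvg_mul_expr z01)).
  - exact: cvg_cst.
apply: (@squeeze_cvgr _ _ _ _ (fun=> 0) (fun n => n.+1%:R^-1)).
- apply: nearW => n; have /andP[a b] := yn n.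
  rewrite exprn_ge0 ?subr_ge0 //=.
  rewrite -[leRHS]mul1r ler_pdivlMr ?ltr0n //.
  apply: le_trans (expr_sub_le (n * K ^ n) (yn n)).
  rewrite ler_wpM2l ?exprn_ge0 ?subr_ge0 // natrM -natr1 addrC lerD2l -mulrA.
  rewrite ler_peMr // natrX -exprMn exprn_ege1 //.
  by rewrite -(ler_pM2l K0') divff ?gt_eqF // in h.
- exact: cvg_cst.
- exact: cvg_harmonic.
Qed.
End Threshold.

Section CosNearInteger.
Variable R : realType.

Lemma cos_near_int (t rho : R) : 0 < rho <= 2^-1 -> cos (2 * pi * rho) < cos (2 * pi * t) ->
  exists m : int, `|t - m%:~R| < rho.
Proof.
move=> /andP[r0 r1] h; exists (Num.floor (t + 2^-1)).
set m := Num.floor _; set s := t - m%:~R.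
have s1 : `|s| <= 2^-1.
  rewrite ler_norml /s /m.
  have := floor_le (t + 2^-1); have := floorD1_gt (t + 2^-1).
  by rewrite intrD; lra.
have cE : cos (2 * pi * t) = cos (2 * pi * `|s|).
  rewrite -[RHS]cos_norm !normrM normr_id -!normrM cos_norm -[RHS](cosD2pi_int _ m).
  by congr cos; rewrite /s; ring.
rewrite ltNge; apply/negP => rs; move: h; rewrite cE ltNge => /negP; apply.
have pi0 : 0 <= (pi : R) by exact: pi_ge0.
have mem x : 0 <= x -> x <= 2^-1 -> 2 * pi * x \in `[0, (pi : R)].
  by move=> x0 x1; rewrite in_itv /= !mulr_ge0 //=; nra.
have := @ltr_cos R; rewrite leNgt => H; rewrite H ?mem // ?(ltW r0) // -leNgt.
by rewrite ler_wpM2l // mulr_ge0.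
Qed.

Lemma cos_near_one (e : R) : 0 < e ->
  exists2 dlt : R, 0 < dlt & forall t, `|t| < dlt -> 1 - cos (2 * pi * t) < e.
Proof.
move=> e0; have c : cos (2 * pi * t) @[t --> (0 : R)] --> (1 : R).
  rewrite -[X in _ --> X](@cos0 R) -[X in _ --> cos X](mulr0 (2 * pi)).
  apply: continuous_cvg; first exact: continuous_cos.
  by apply: cvgMl_tmp; exact: cvg_id.
have /cvgrPdist_lt /(_ e e0) [dlt /= d0 H] := c.
exists dlt => // t td; have := H t; rewrite /= sub0r normrN => /(_ td).
by move=> h; apply: le_lt_trans h; exact: ler_norm.
Qed.
End CosNearInteger.

(** * Approximation by trigonometric polynomials *)

Section Density.
Variable R : realType.
Local Notation T := (torus R).
Local Open Scope quotient_scope.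
Variable nu : probability T R.
Variable gs : seq GL2Z.
Local Notation bm := bounded_measurable.
Local Notation E := (mean nu).
Implicit Types (f h : T -> R) (p : seq (R * 'rV[int]_2 * R)) (x : T).

(** A squared norm of [f] taken together with its compositions by the elements of [gs]:
    an approximation in this sense remains one after averaging. *)
Definition orbit_energy f : R := E (fun x => \sum_(g <- gs) f (torus_act g x) ^+ 2).

Definition approximable f := bm f /\
  forall e : R, 0 < e -> exists p, orbit_energy (fun x => f x - trig p x) < e.

Lemma bm_orbit f : bm f -> bm (fun x => \sum_(g <- gs) f (torus_act g x) ^+ 2).
Proof. by move=> bf; apply: bm_sum => g; apply: bmX; exact: bm_act. Qed.

Lemma orbit_energyD f h : bm f -> bm h ->
  orbit_energy (fun x => f x + h x) <= 2 * orbit_energy f + 2 * orbit_energy h.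
Proof.
move=> bf bh; rewrite /orbit_energy -!meanZ; try exact: bm_orbit.
have b2 (k : T -> R) : bm k -> bm (fun x => 2 * \sum_(g <- gs) k (torus_act g x) ^+ 2).
  by move=> bk; apply: bmZ; exact: bm_orbit.
rewrite -meanD; [|exact: b2|exact: b2].
apply: le_mean.
- by apply: (@bm_orbit (fun x => f x + h x)); exact: bmD.
- by apply: bmD; exact: b2.
move=> x; rewrite !mulr_sumr -big_split /=; apply: ler_sum => g _.
by have := sqr_ge0 (f (torus_act g x) - h (torus_act g x)); nra.
Qed.

Lemma approximable_close f : bm f ->
  (forall e, 0 < e -> exists2 h, approximable h & orbit_energy (fun x => f x - h x) < e) ->
  approximable f.
Proof.
move=> bf H; split=> // e e0.
have e4 : 0 < e / 4 by rewrite divr_gt0.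
have [h [bh /(_ _ e4) [p hp]] fh] := H _ e4.
exists p.
have -> : (fun x => f x - trig p x) = (fun x => (f x - h x) + (h x - trig p x)).
  by apply/funext => x; rewrite addrA subrK.
apply: le_lt_trans (orbit_energyD (bmB bf bh) (bmB bh (bm_trig p))) _.
by lra.
Qed.

Lemma orbit_energyZ c f : bm f -> orbit_energy (fun x => c * f x) = c ^+ 2 * orbit_energy f.
Proof.
move=> bf; rewrite /orbit_energy -meanZ; last exact: bm_orbit.
by congr mean; apply/funext => x; rewrite mulr_sumr; apply: eq_bigr => g _; rewrite exprMn.
Qed.

Lemma orbit_energy_ge0 f : 0 <= orbit_energy f.
Proof. by apply: mean_ge0 => x; apply: sumr_ge0 => g _; exact: sqr_ge0. Qed.

Definition is_trig f := exists p, f = trig p.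

Lemma is_trigD f h : is_trig f -> is_trig h -> is_trig (fun x => f x + h x).
Proof.
move=> [p ->] [s ->]; exists (p ++ s); apply/funext => x.
by rewrite /trig big_cat.
Qed.

Lemma is_trigZ c f : is_trig f -> is_trig (fun x => c * f x).
Proof.
move=> [p ->]; exists [seq (c * e.1.1, e.1.2, e.2) | e <- p]; apply/funext => x.
by rewrite /trig big_map mulr_sumr; apply: eq_bigr => e _; rewrite mulrA.
Qed.

Lemma is_trig_cst c : is_trig (fun=> c).
Proof.
exists [:: (c, 0, 0)]; apply/funext => x.
by rewrite /trig big_seq1 wave0 cos0 mulr1.
Qed.

Lemma is_trig_wave v th : is_trig (wave v th).
Proof.
by exists [:: (1, v, th)]; apply/funext => x; rewrite /trig big_seq1 mul1r.
Qed.

Lemma is_trig_sum (I : Type) (s : seq I) (F : I -> T -> R) :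
  (forall i, is_trig (F i)) -> is_trig (fun x => \sum_(i <- s) F i x).
Proof.
move=> H; elim: s => [|i s IH].
  by under eq_fun do rewrite big_nil; exact: is_trig_cst.
by under eq_fun do rewrite big_cons; exact: is_trigD.
Qed.

Lemma is_trigM f h : is_trig f -> is_trig h -> is_trig (fun x => f x * h x).
Proof.
move=> [p ->] [s ->]; under eq_fun do rewrite /trig big_distrlr /=.
apply: is_trig_sum => c; apply: is_trig_sum => e.
under eq_fun do rewrite mulrACA waveM.
by apply: is_trigZ; apply: is_trigD; apply: is_trigZ; exact: is_trig_wave.
Qed.

Lemma is_trigX f n : is_trig f -> is_trig (fun x => f x ^+ n).
Proof.
move=> tf; elim: n => [|n IH]; first exact: is_trig_cst.
by under eq_fun do rewrite exprS; exact: is_trigM.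
Qed.

Lemma is_trigB f h : is_trig f -> is_trig h -> is_trig (fun x => f x - h x).
Proof.
move=> tf th; under eq_fun do rewrite -mulN1r.
by apply: is_trigD => //; exact: is_trigZ.
Qed.

Lemma bm_is_trig f : is_trig f -> bm f.
Proof. by move=> [p ->]; exact: bm_trig. Qed.

Lemma approximable_trig f : is_trig f -> approximable f.
Proof.
move=> tf; split; first exact: bm_is_trig.
move=> e e0; have [p fp] := tf; exists p.
rewrite (_ : (fun x => _) = fun=> 0); last by apply/funext => x; rewrite fp subrr.
rewrite /orbit_energy (_ : (fun x => _) = fun=> 0) ?mean_cst //.
by apply/funext => x; rewrite big1 // => g _; rewrite expr0n.
Qed.

Lemma approximableD f h : approximable f -> approximable h ->
  approximable (fun x => f x + h x).
Proof.
move=> [bf Hf] [bh Hh]; split; first exact: bmD.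
move=> e e0; have e4 : 0 < e / 4 by rewrite divr_gt0.
have [p fp] := Hf _ e4; have [s hs] := Hh _ e4.
exists (p ++ s).
have -> : (fun x => f x + h x - trig (p ++ s) x) =
    (fun x => (f x - trig p x) + (h x - trig s x)).
  by apply/funext => x; rewrite /trig big_cat /= opprD addrACA.
apply: le_lt_trans (orbit_energyD (bmB bf (bm_trig p)) (bmB bh (bm_trig s))) _.
by lra.
Qed.

Lemma approximableZ c f : approximable f -> approximable (fun x => c * f x).
Proof.
move=> [bf Hf]; apply: approximable_close; first exact: bmZ.
move=> e e0; have d0 : 0 < c ^+ 2 + 1 by rewrite ltr_wpDl // sqr_ge0.
have [p fp] := Hf (e / (c ^+ 2 + 1)) (divr_gt0 e0 d0).
exists (fun x => c * trig p x).
  by apply: approximable_trig; apply: is_trigZ; exists p.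
have -> : (fun x => c * f x - c * trig p x) = (fun x => c * (f x - trig p x)).
  by apply/funext => x; rewrite mulrBr.
rewrite orbit_energyZ; last by apply: bmB => //; exact: bm_trig.
move: fp; rewrite ltr_pdivlMr // mulrC => fp; apply: le_lt_trans fp.
by rewrite ler_wpM2r ?orbit_energy_ge0 // lerDl.
Qed.

(** Bounded convergence. *)
Lemma approximable_limit (f_ : nat -> T -> R) f M :
  (forall n, approximable (f_ n)) -> (forall n x, `|f_ n x| <= M) ->
  (forall x, f_ ^~ x @ \oo --> f x) -> approximable f.
Proof.
move=> af fM cvf.
have [bf _] := bounded_convergence nu (fun n => (af n).1.1) fM cvf.
apply: approximable_close => // e e0.
have fM' x : `|f x| <= M.
  have h : `|f_ n x| @[n --> \oo] --> `|f x| by apply: cvg_norm; exact: cvf.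
  rewrite -(cvg_lim _ h) //; apply: limr_le; first by apply/cvg_ex; eexists; exact: h.
  by apply: nearW => n; exact: fM.
pose F n x := \sum_(g <- gs) (f (torus_act g x) - f_ n (torus_act g x)) ^+ 2.
have bF n : bm (F n) by apply: (@bm_orbit (fun x => f x - f_ n x)); apply: bmB => //; case: (af n).
have FM n x : `|F n x| <= \sum_(g <- gs) (2 * M) ^+ 2.
  rewrite ger0_norm; last by apply: sumr_ge0 => g _; exact: sqr_ge0.
  apply: ler_sum => g _; rewrite -[leLHS]ger0_norm ?sqr_ge0 // normrX.
  apply: exprn_mono; first exact: normr_ge0.
  apply: le_trans (ler_normB _ _) _; rewrite mulr2n mulrDl mul1r.
  by rewrite lerD.
have Fcv x : F ^~ x @ \oo --> (0 : R).
  rewrite /F; elim: gs => [|g s IH].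
    by under eq_fun do rewrite big_nil; exact: cvg_cst.
  under eq_fun do rewrite big_cons expr2.
  have h1 : f (torus_act g x) - f_ n (torus_act g x) @[n --> \oo] --> (0 : R).
    have h0 := cvgB (cvg_cst (f (torus_act g x))) (cvf (torus_act g x)).
    by rewrite subrr in h0; exact: h0.
  have h2 := cvgD (cvgM h1 h1) IH.
  by rewrite mulr0 addr0 in h2; exact: h2.
have [_ EF] := bounded_convergence nu (fun n => (bF n).1) FM Fcv.
move: EF; rewrite mean_cst => /cvgrPdist_lt /(_ e e0) [N _ /(_ N (leqnn N)) /= H].
exists (f_ N) => //; move: H; rewrite sub0r normrN ger0_norm //.
exact: (orbit_energy_ge0 (fun x => f x - f_ N x)).
Qed.
End Density.

(** * Trigonometric polynomials generate the Borel sets *)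

Section TrigSigmaAlgebra.
Variable R : realType.
Local Notation T := (torus R).
Local Open Scope quotient_scope.
Implicit Types (f h p : T -> R) (x : T) (A : set T).

(** A pi-system, since approximations of indicators can be multiplied. *)
Definition trig_limit_sets : set (set T) := [set A | measurable A /\
  exists q : nat -> T -> R, [/\ forall n, is_trig (q n), forall n x, `|q n x| <= 1 &
    forall x, q ^~ x @ \oo --> (\1_A x : R)]].

Lemma trig_limit_setsI : setI_closed trig_limit_sets.
Proof.
move=> A B [mA [q [tq q1 cq]]] [mB [s [ts s1 cs]]]; split; first exact: measurableI.
exists (fun n x => q n x * s n x); split.
- by move=> n; exact: is_trigM.
- by move=> n x; rewrite normrM mulr_ile1.
- by move=> x; rewrite indicI /=; exact: (cvgM (cq x) (cs x)).
Qed.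

Lemma trig_sublevel p (K : nat) : is_trig p -> (forall x, 0 <= p x <= 1) -> (0 < K)%N ->
  trig_limit_sets [set x | p x < K%:R^-1].
Proof.
move=> tp p01 K0; split.
  have -> : [set x | p x < K%:R^-1] = setT `&` p @^-1` [set` `]-oo, K%:R^-1[].
    by apply/seteqP; split => x /=; rewrite in_itv //=; tauto.
  have [mp _] := bm_is_trig tp.
  by apply: mp.
exists (fun n x => (1 - p x ^+ n) ^+ (n * K ^ n)); split.
- by move=> n; apply: is_trigX; apply: is_trigB; [exact: is_trig_cst|exact: is_trigX].
- move=> n x; have /andP[p0 p1] := p01 x.
  rewrite normrX exprn_ile1 // ger0_norm ?subr_ge0 ?exprn_ile1 // gerBl.
  exact: exprn_ge0.
- move=> x; have := cvg_threshold K0 (p01 x).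
  rewrite indicE (_ : (x \in [set x | p x < K%:R^-1]) = (p x < K%:R^-1)) //.
  by apply/idP/idP; rewrite inE.
Qed.

(** At the class of [u] this is half the sum of the squares of [sin (pi * (u 0 0 - a))] and
    [sin (pi * (u 1 0 - b))]; it vanishes only at the class of [(a, b)], and its sublevel
    sets shrink to that point. *)
Definition bump (a b : R) x : R :=
  4^-1 * ((1 - wave (delta_mx 0 0) (- (2 * pi * a)) x) +
          (1 - wave (delta_mx 0 1) (- (2 * pi * b)) x)).

Lemma bump_trig a b : is_trig (bump a b).
Proof.
by apply: is_trigZ; apply: is_trigD; apply: is_trigB; do ?[exact: is_trig_cst|exact: is_trig_wave].
Qed.

Lemma bump01 a b x : 0 <= bump a b x <= 1.
Proof.
rewrite /bump; set y := wave _ _ _; set z := wave _ _ _.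
have : `|y| <= 1 by exact: wave_le1.
have : `|z| <= 1 by exact: wave_le1.
by rewrite !ler_norml => /andP[? ?] /andP[? ?]; apply/andP; split; lra.
Qed.

Lemma bump_pi a b (u : 'cV[R]_2) : bump a b (\pi_T u) =
  4^-1 * ((1 - cos (2 * pi * (u 0 0 - a))) + (1 - cos (2 * pi * (u 1 0 - b)))).
Proof.
rewrite /bump !wave_pi !pairingE !mxE /= !mul1r !mul0r addr0 add0r.
by rewrite -!mulrBr.
Qed.

(** Rational centres and inverse integers as levels make a countable base of open sets. *)
Lemma bump_base (O : set T) x : open O -> O x ->
  exists a b (K : nat), bump (ratr a) (ratr b) x < K.+1%:R^-1 /\
    [set y | bump (ratr a) (ratr b) y < K.+1%:R^-1] `<=` O.
Proof.
move=> oO; rewrite -[x]torus_reprK; set u := repr x => Ou.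
have oP : open ((\pi_T : 'cV[R]_2 -> T) @^-1` O) by [].
have /nbhs_ballP [r0 /= r0_gt0 ball_sub] : nbhs u ((\pi_T : 'cV[R]_2 -> T) @^-1` O).
  exact: open_nbhs_nbhs.
pose rho := Num.min (r0 / 2) 2^-1.
have rho0 : 0 < rho by rewrite lt_min divr_gt0 //= invr_gt0.
have rho_half : rho <= 2^-1 by rewrite ge_min lexx orbT.
have rho_r0 : rho <= r0 / 2 by rewrite ge_min lexx.
have pi0 : 0 < (pi : R) := pi_gt0 R.
have c1 : cos (2 * pi * rho) < 1 :> R.
  rewrite -[X in _ < X](@cos0 R); have := @ltr_cos R => ->; rewrite ?in_itv /=.
  - by rewrite !mulr_gt0.
  - by rewrite lexx ltW.
  - by rewrite !mulr_ge0 ?(ltW rho0) ?(ltW pi0) //=; nra.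
(* a bump value below eta / 4 forces both cosines above cos (2 pi rho) *)
pose eta : R := 1 - cos (2 * pi * rho); have eta0 : 0 < eta by rewrite subr_gt0.
pose K := Num.bound (4 / eta).
have K1 : 4 * K.+1%:R^-1 < eta.
  rewrite ltr_pdivrMr // mulrC -ltr_pdivrMr //.
  apply: lt_trans (archi_boundP _) _; first by rewrite divr_ge0 // ltW.
  by rewrite ltr_nat.
have Ki0 : 0 < K.+1%:R^-1 :> R by rewrite invr_gt0.
have [dlt dlt0 Hd] := cos_near_one Ki0.
pose s := Num.min dlt rho; have s0 : 0 < s by rewrite lt_min dlt0.
have rat_near (t : R) : exists a : rat, `|t - ratr a| < s.
  have : t - s < t + s by lra.
  move=> /rat_in_itvoo[a]; rewrite in_itv /= => /andP[h1 h2]; exists a.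
  by rewrite ltr_norml; apply/andP; split; lra.
have [a ha] := rat_near (u 0 0); have [b hb] := rat_near (u 1 0).
exists a, b, K; split.
  rewrite bump_pi.
  have h1 : 1 - cos (2 * pi * (u 0 0 - ratr a)) < K.+1%:R^-1.
    by apply: Hd; apply: lt_le_trans ha _; rewrite ge_min lexx.
  have h2 : 1 - cos (2 * pi * (u 1 0 - ratr b)) < K.+1%:R^-1.
    by apply: Hd; apply: lt_le_trans hb _; rewrite ge_min lexx.
  move: h1 h2 Ki0; move: (cos (_ * (u 0 0 - _))) (cos (_ * (u 1 0 - _))) => A B.
  move: (K.+1%:R^-1) => k; lra.
move=> y /=; rewrite -[y]torus_reprK; set w := repr y; rewrite bump_pi => hy.
have y1 := cos_le1 (2 * pi * (w 0 0 - ratr a)); have y2 := cos_le1 (2 * pi * (w 1 0 - ratr b)).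
have rr : 0 < rho <= 2^-1 by rewrite rho0.
have [m hm] : exists m : int, `|w 0 0 - ratr a - m%:~R| < rho.
  apply: cos_near_int rr _; move: K1 hy y1 y2; rewrite /eta.
  move: (cos (_ * (w 0 0 - _))) (cos (_ * (w 1 0 - _))) (cos _) => A B C.
  by move: (K.+1%:R^-1) => k; lra.
have [l hl] : exists m : int, `|w 1 0 - ratr b - m%:~R| < rho.
  apply: cos_near_int rr _; move: K1 hy y1 y2; rewrite /eta.
  move: (cos (_ * (w 0 0 - _))) (cos (_ * (w 1 0 - _))) (cos _) => A B C.
  by move: (K.+1%:R^-1) => k; lra.
(* integer translation that brings y within 2 rho of u *)
pose d : 'cV[R]_2 := \col_i (if i == 0 then m%:~R else l%:~R).
have -> : \pi_T w = \pi_T (w - d).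
  apply/torus_pi_eq; rewrite opprB addrC subrK; apply/mxOverP => i j.
  by rewrite mxE; case: ifP => _; exact: intr_int.
apply: ball_sub; split=> // i j; rewrite ord1.
have sr : s <= rho by rewrite ge_min lexx orbT.
elim/ord2P: i; rewrite /ball /= !mxE /=.
  move: ha hm; rewrite !ltr_norml => /andP[? ?] /andP[? ?].
  by apply/andP; split; lra.
move: hb hl; rewrite !ltr_norml => /andP[? ?] /andP[? ?].
by apply/andP; split; lra.
Qed.

Lemma torus_measurableE : @measurable _ T = <<s trig_limit_sets >>.
Proof.
apply/seteqP; split; last first.
  apply: smallest_sub; first exact: sigma_algebra_measurable.
  by move=> A [].
apply: smallest_sub; first exact: smallest_sigma_algebra.
move=> O oO.
pose F (i : rat * rat * nat) : set T :=
  if `[< [set y | bump (ratr i.1.1) (ratr i.1.2) y < i.2.+1%:R^-1] `<=` O >]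
  then [set y | bump (ratr i.1.1) (ratr i.1.2) y < i.2.+1%:R^-1] else set0.
have -> : O = \bigcup_i F i.
  apply/seteqP; split => [x Ox|x [i _]]; last first.
    by rewrite /F; case: asboolP => // + ?; apply.
  have [a [b [K [h1 h2]]]] := bump_base oO Ox.
  by exists (a, b, K) => //; rewrite /F /= asboolT.
apply: (@countable_bigcupT_measurable _ (g_sigma_algebraType trig_limit_sets)).
  exact: countableP.
move=> i; rewrite /F; case: asboolP => _; last exact: measurable0.
apply: sub_sigma_algebra; apply: trig_sublevel => //; first exact: bump_trig.
by move=> x; exact: bump01.
Qed.
End TrigSigmaAlgebra.

Section ApproximableSets.
Variable R : realType.
Local Notation T := (torus R).
Variable nu : probability T R.
Variable gs : seq GL2Z.

(** Dynkin's pi-lambda argument: approximability of the indicator passes to complements and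
    to disjoint countable unions. *)
Lemma approximable_indic (A : set T) : measurable A -> approximable nu gs (\1_A : T -> R).
Proof.
rewrite torus_measurableE => mA.
apply: (@dynkin_induction _ T (@trig_limit_sets R) (fun A => approximable nu gs (\1_A : T -> R))) => //.
- exact: torus_measurableE.
- exact: trig_limit_setsI.
- by rewrite indicT; apply: approximable_trig; exact: is_trig_cst.
- move=> B [mB [q [tq q1 cq]]]; apply: (approximable_limit (M := 1) _ q1 cq).
  by move=> n; exact: approximable_trig.
- move=> S mS aS; rewrite (_ : \1_(~` S) = fun x : T => 1 + (-1) * (\1_S x : R)).
    by apply: approximableD; [apply: approximable_trig; exact: is_trig_cst|exact: approximableZ].
  by apply/funext => x; rewrite indicC indicE mulN1r; case: (_ \in _); rewrite ?subrr ?subr0.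
move=> F mF tF aF.
pose f n (x : T) : R := \sum_(k <- iota 0 n) \1_(F k) x.
have f1 x k0 n : F k0 x -> f n x = (k0 < n)%N%:R.
  move=> Fx; rewrite /f (eq_bigr (fun k => (k0 == k)%:R)).
    by rewrite sum_eq_count count_uniq_mem ?iota_uniq // mem_iota.
  move=> k _; rewrite indicE; congr ((nat_of_bool _)%:R); apply/idP/eqP => [|<-]; last by rewrite inE.
  rewrite inE => Fkx; have [//|kk] := eqVneq k0 k.
  by have /trivIsetP /(_ k0 k I I kk) := tF => /seteqP[/(_ x) /= h _]; case: h.
have f0 x n : (forall k, ~ F k x) -> f n x = 0.
  by move=> h; rewrite /f big1 // => k _; rewrite indicE memNset.
apply: (@approximable_limit _ _ _ f _ 1).
- move=> n; rewrite /f; elim: (iota 0 n) => [|k s IH].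
    by under eq_fun do rewrite big_nil; apply: approximable_trig; exact: is_trig_cst.
  by under eq_fun do rewrite big_cons; exact: approximableD.
- move=> n x; have [[k Fk]|h] := pselect (exists k, F k x).
    by rewrite (f1 _ _ _ Fk) normr_nat; case: (_ < _)%N.
  by rewrite f0 ?normr0 // => k Fk; apply: h; exists k.
- move=> x; have [[k Fk]|h] := pselect (exists k, F k x).
    rewrite indicE mem_set; last by exists k.
    apply: cvg_near_cst; exists k.+1 => // n /= kn.
    by rewrite (f1 _ _ _ Fk) kn.
  rewrite indicE memNset; last by move=> [k _ Fk]; apply: h; exists k.
  apply: cvg_near_cst; apply: nearW => n.
  by apply: f0 => k Fk; apply: h; exists k.
Qed.
End ApproximableSets.

(** * From trigonometric polynomials to square integrable functions *)

Section L2seminorm.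
Context (d : measure_display) (T : measurableType d) (R : realType).
Variable P : probability T R.
Implicit Types f g : T -> R.
Local Notation bm := bounded_measurable.
Local Notation E := (mean P).

Definition l2 f : R := Num.sqrt (E (fun x => f x ^+ 2)).

Lemma mean_sqr_ge0 f : 0 <= E (fun x => f x ^+ 2).
Proof. by apply: mean_ge0 => x; exact: sqr_ge0. Qed.

Lemma l2_ge0 f : 0 <= l2 f.
Proof. exact: sqrtr_ge0. Qed.

Lemma l2_sqr f : l2 f ^+ 2 = E (fun x => f x ^+ 2).
Proof. by rewrite sqr_sqrtr // mean_sqr_ge0. Qed.

Lemma l2_le f (c : R) : 0 <= c -> E (fun x => f x ^+ 2) <= c ^+ 2 -> l2 f <= c.
Proof. by move=> c0 h; rewrite -(ler_pXn2r (ltn0Sn 1)) ?nnegrE ?l2_ge0 // l2_sqr. Qed.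

Lemma l2_triangle f g : bm f -> bm g -> l2 (fun x => f x + g x) <= l2 f + l2 g.
Proof.
move=> bf bg; apply: l2_le; first by rewrite addr_ge0 ?l2_ge0.
have bf2 := bmX 2 bf; have bg2 := bmX 2 bg; have bfg := bmM bf bg.
have -> : (fun x => (f x + g x) ^+ 2) = (fun x => (f x ^+ 2 + g x ^+ 2) + 2 * (f x * g x)).
  by apply/funext => x; ring.
rewrite meanD ?meanD ?meanZ //; [|exact: bmD|exact: bmZ].
rewrite sqrrD !l2_sqr -[l2 f * l2 g *+ 2]mulr_natl [leRHS]addrAC lerD2l ler_wpM2l //.
apply: le_trans (ler_norm _) _.
rewrite -ler_sqr ?nnegrE ?mulr_ge0 ?l2_ge0 // real_normK ?num_real // exprMn !l2_sqr.
exact: mean_cauchy_schwarz.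
Qed.

Lemma l2_cst (c : R) : l2 (fun=> c) = `|c|.
Proof. by rewrite /l2 mean_cst sqrtr_sqr. Qed.

Lemma normr_mean_le f : bm f -> `|E f| <= l2 f.
Proof. by move=> bf; rewrite -sqrtr_sqr /l2 ler_wsqrtr // mean_sqr_ge. Qed.
End L2seminorm.

Section Deviation.
Import HBNNSimple.
Variable R : realType.
Local Notation T := (torus R).
Variable nu : probability T R.
Variable D : seq GL2Z.
Hypothesis D0 : (0 < size D)%N.
Variable kap : R.
Hypothesis kap0 : 0 <= kap.
Local Notation bm := bounded_measurable.
Local Notation E := (mean nu).
Local Notation S := ((size D)%:R : R).

Definition deviation (f : T -> R) (m : R) (x : T) : R :=
  S^-1 * (\sum_(g <- D) f (torus_act g x)) - m.

Hypothesis trig_bound : forall p,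
  E (fun x => deviation (trig p) (E (trig p)) x ^+ 2) <=
  kap ^+ 2 * E (fun x => trig p x ^+ 2).

Lemma bm_deviation f m : bm f -> bm (deviation f m).
Proof.
move=> bf; apply: bmB; last exact: bm_cst.
by apply: bmZ; apply: bm_sum => g; exact: bm_act.
Qed.

(** The mean and the average are both continuous for [orbit_energy] over [1 :: D]. *)
Lemma deviation_approximable f : approximable nu (1%g :: D) f ->
  E (fun x => deviation f (E f) x ^+ 2) <= kap ^+ 2 * E (fun x => f x ^+ 2).
Proof.
move=> [bf Hf].
have S0 : 0 < S by rewrite ltr0n.
suff H : l2 nu (deviation f (E f)) <= kap * l2 nu f.
  rewrite -!l2_sqr -exprMn; apply: exprn_mono => //; exact: l2_ge0.
apply/ler_addgt0Pr => e e0.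
(* the errors to absorb are kap * t for the polynomial, t for the average, t for the mean *)
pose t := e / (kap + 2).
have k2 : 0 < kap + 2 by rewrite ltr_wpDl.
have t0 : 0 < t by rewrite divr_gt0.
have [p] := Hf (t ^+ 2) (exprn_gt0 2 t0).
set h := fun x => f x - trig p x => hp.
have bh : bm h by apply: bmB => //; exact: bm_trig.
have bp := bm_trig p.
have [hp1 hpD] : E (fun x => h x ^+ 2) <= t ^+ 2 /\
    \sum_(g <- D) E (fun x => h (torus_act g x) ^+ 2) <= t ^+ 2.
  move: hp; rewrite /orbit_energy mean_sum; last first.
    by move=> g; apply: bmX; exact: bm_act.
  rewrite big_cons.
  have -> : (fun x => h (torus_act 1%g x) ^+ 2) = (fun x => h x ^+ 2).
    by apply/funext => x; rewrite torus_act1.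
  set a := E _; set b := \sum_(g <- D) _ => hab.
  have a0 : 0 <= a by exact: mean_sqr_ge0.
  have b0 : 0 <= b by apply: sumr_ge0 => g _; exact: mean_sqr_ge0.
  by split; lra.
have lh : l2 nu h <= t by apply: l2_le => //; exact: ltW.
have lU : l2 nu (fun x => S^-1 * \sum_(g <- D) h (torus_act g x)) <= t.
  apply: l2_le; first exact: ltW.
  apply: (@le_trans _ _ (E (fun x => S^-1 * \sum_(g <- D) h (torus_act g x) ^+ 2))).
    apply: le_mean => [||x].
    - by apply: bmX; apply: bmZ; apply: bm_sum => g; exact: bm_act.
    - by apply: bmZ; apply: bm_sum => g; apply: bmX; exact: bm_act.
    rewrite exprMn expr2 -mulrA ler_wpM2l ?invr_ge0 ?ler0n //.
    by rewrite ler_pdivrMl // sqr_sum_le.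
  rewrite meanZ; last by apply: bm_sum => g; apply: bmX; exact: bm_act.
  rewrite mean_sum; last by move=> g; apply: bmX; exact: bm_act.
  rewrite ler_pdivrMl //; apply: le_trans hpD _.
  by rewrite ler_peMl ?sqr_ge0 // ler1n.
have bU : bm (fun x => S^-1 * \sum_(g <- D) h (torus_act g x)).
  by apply: bmZ; apply: bm_sum => g; exact: bm_act.
have devE : deviation f (E f) = (fun x => deviation (trig p) (E (trig p)) x +
    (S^-1 * (\sum_(g <- D) h (torus_act g x)) + (- E h))).
  apply/funext => x; rewrite /deviation /h meanB // sumrB; ring.
have bdp := bm_deviation (E (trig p)) bp.
rewrite devE; apply: le_trans (l2_triangle nu bdp (bmD bU (bm_cst _ (- E h)))) _.
have l1 : l2 nu (deviation (trig p) (E (trig p))) <= kap * l2 nu (trig p).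
  apply: l2_le; first by rewrite mulr_ge0 ?l2_ge0.
  by rewrite exprMn l2_sqr.
have l3 := l2_triangle nu bU (bm_cst _ (- E h)).
have l4 : l2 nu (fun=> - E h) <= t.
  by rewrite l2_cst normrN; apply: le_trans lh; exact: normr_mean_le.
have l5 : l2 nu (trig p) <= l2 nu f + t.
  have -> : trig p = (fun x => f x + (-1) * h x) by apply/funext => x; rewrite /h; ring.
  apply: le_trans (l2_triangle nu bf (bmZ (-1) bh)) _; rewrite lerD2l.
  rewrite /l2 (_ : (fun x => _) = (fun x => h x ^+ 2)) //.
  by apply/funext => x; ring.
have l6 := ler_wpM2l kap0 l5.
have te : t * (kap + 2) = e by rewrite divfK // gt_eqF.
apply: (@le_trans _ _ (kap * (l2 nu f + t) + (t + t))).
  apply: lerD; first exact: le_trans l1 l6.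
  by apply: le_trans l3 _; exact: lerD.
rewrite -te [X in X <= _](_ : _ = kap * l2 nu f + t * (kap + 2)) //.
by ring.
Qed.

Lemma approximable_nnsfun gs (f : {nnsfun T >-> R}) : approximable nu gs (f : T -> R).
Proof.
have -> : (f : T -> R) = fun x => \sum_(y <- fset_set (range f)) y * \1_(f @^-1` [set y]) x.
  apply/funext => x; rewrite [LHS]fimfunE fsbig_finite //=.
elim: (fset_set _ : seq R) => [|y s IH].
  by under eq_fun do rewrite big_nil; apply: approximable_trig; exact: is_trig_cst.
under eq_fun do rewrite big_cons.
apply: approximableD => //; apply: approximableZ; apply: approximable_indic.
exact: measurable_sfunP.
Qed.

Lemma nnsfun_below (u : T -> R) : measurable_fun setT u -> (forall x, 0 <= u x) ->
  exists a : {nnsfun T >-> R}^nat,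
    (forall n x, a n x <= u x) /\ (forall x, a ^~ x @ \oo --> u x).
Proof.
move=> mu u0; have mu' : measurable_fun setT (EFin \o u) by exact/measurable_EFinP.
exists (nnsfun_approx measurableT mu').
have cv x : (nnsfun_approx measurableT mu') ^~ x @ \oo --> u x.
  have h : forall x, setT x -> (0 <= (EFin \o u) x)%E by move=> y _; rewrite lee_fin.
  exact: fine_cvg (cvg_nnsfun_approx measurableT mu' h I).
split=> // n x; rewrite -[leRHS](cvg_lim _ (cv x)) //.
apply: (@nondecreasing_cvgn_le _ (fun n => nnsfun_approx measurableT mu' n x)).
  by move=> m k mk; exact/lefP/nd_nnsfun_approx.
by apply/cvg_ex; eexists; exact: cv.
Qed.

(** Simple functions increasing to the positive and to the negative part. *)
Lemma approximable_below (u : T -> R) gs : measurable_fun setT u ->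
  exists phi : nat -> T -> R, [/\ forall k, approximable nu gs (phi k),
    forall k x, `|phi k x| <= `|u x| & forall x, phi ^~ x @ \oo --> u x].
Proof.
move=> mu; pose up x := Num.max (u x) 0; pose un x := Num.max (- u x) 0.
have mup : measurable_fun setT up by apply: measurable_maxr => //; exact: measurable_cst.
have mun : measurable_fun setT un.
  by apply: measurable_maxr => //; exact: measurableT_comp.
have [a [au ca]] : exists a : {nnsfun T >-> R}^nat,
    (forall n x, a n x <= up x) /\ (forall x, a ^~ x @ \oo --> up x).
  by apply: nnsfun_below => // x; rewrite le_max lexx orbT.
have [b [bu cb]] : exists b : {nnsfun T >-> R}^nat,
    (forall n x, b n x <= un x) /\ (forall x, b ^~ x @ \oo --> un x).
  by apply: nnsfun_below => // x; rewrite le_max lexx orbT.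
exists (fun k x => a k x + (-1) * b k x); split.
- move=> k; apply: approximableD; first exact: approximable_nnsfun.
  by apply: approximableZ; exact: approximable_nnsfun.
- move=> k x; have := au k x; have := bu k x.
  have a0 : 0 <= a k x by exact: fun_ge0.
  have b0 : 0 <= b k x by exact: fun_ge0.
  rewrite /up /un mulN1r; case: (boolP (0 <= u x)) => [ux|]; last (rewrite -ltNge => ux).
    have -> : Num.max (- u x) 0 = 0 by apply/max_idPr; rewrite oppr_le0.
    have -> : Num.max (u x) 0 = u x by apply/max_idPl.
    move=> b00 aux.
    have -> : b k x = 0 by apply/eqP; rewrite eq_le b0 b00.
    by rewrite subr0 !ger0_norm.
  have -> : Num.max (- u x) 0 = - u x by apply/max_idPl; rewrite oppr_ge0 ltW.
  have -> : Num.max (u x) 0 = 0 by apply/max_idPr; rewrite ltW.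
  move=> bux a00.
  have -> : a k x = 0 by apply/eqP; rewrite eq_le a0 a00.
  by rewrite add0r normrN ger0_norm // ltr0_norm.
- move=> x; have -> : u x = up x + (-1) * un x.
    rewrite /up /un; case: (boolP (0 <= u x)) => [ux|]; last (rewrite -ltNge => ux).
      have -> : Num.max (- u x) 0 = 0 by apply/max_idPr; rewrite oppr_le0.
      have -> : Num.max (u x) 0 = u x by apply/max_idPl.
      by ring.
    have -> : Num.max (- u x) 0 = - u x by apply/max_idPl; rewrite oppr_ge0 ltW.
    have -> : Num.max (u x) 0 = 0 by apply/max_idPr; rewrite ltW.
    by ring.
  exact: (cvgD (ca x) (cvgMl_tmp (cb x))).
Qed.

Lemma fatou_le (F_ : nat -> T -> R) (F : T -> R) (A : \bar R) :
  (forall k, measurable_fun setT (F_ k)) -> (forall k x, 0 <= F_ k x) ->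
  (forall x, F_ ^~ x @ \oo --> F x) ->
  (forall k, (\int[nu]_x (F_ k x)%:E <= A)%E) -> (\int[nu]_x (F x)%:E <= A)%E.
Proof.
move=> mF F0 cF FA.
have := @fatou _ T R nu setT measurableT (fun k x => (F_ k x)%:E).
have m k : measurable_fun setT (fun x => (F_ k x)%:E) by exact/measurable_EFinP.
have p k x : setT x -> (0 <= (F_ k x)%:E)%E by rewrite lee_fin.
move=> /(_ m p) fat; apply: le_trans (le_trans _ fat) _.
  rewrite le_eqVlt; apply/orP; left; apply/eqP; apply: eq_integral => x _.
  have h : (F_ k x)%:E @[k --> \oo] --> (F x)%:E.
    by apply/fine_cvgP; split; [exact: nearW|exact: cF].
  by rewrite (cvg_limn_einf_sup h).1.
rewrite limn_einf_lim; apply: lime_le; first exact: is_cvg_einfs.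
apply: nearW => k; apply: le_trans (FA k).
by apply: ereal_inf_lbound; exists k => /=.
Qed.

Lemma L2_integrable (u : T -> R) : measurable_fun setT u ->
  (\int[nu]_x (u x ^+ 2)%:E < +oo)%E -> nu.-integrable setT (EFin \o u).
Proof.
move=> mu u2; apply/integrableP; split; first exact/measurable_EFinP.
have mu2 : measurable_fun setT (fun x => (u x ^+ 2)%:E).
  by apply/measurable_EFinP; exact: measurable_funX.
apply: (@le_lt_trans _ _ (\int[nu]_x (1 + (u x ^+ 2)%:E))%E).
  apply: ge0_le_integral => //.
  - by apply: measurableT_comp => //; exact/measurable_EFinP.
  - by apply: emeasurable_funD => //; exact: measurable_cst.
  move=> x _; rewrite /= -EFinD lee_fin.
  have := sqr_ge0 (`|u x| - 1); have := normr_ge0 (u x).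
  by rewrite -[u x ^+ 2]real_normK ?num_real //; nra.
rewrite ge0_integralD //; last by move=> x _; rewrite lee_fin sqr_ge0.
rewrite integral_cst // mul1e; have := @probability_setT _ _ _ nu => /= ->.
by rewrite lte_add_pinfty ?ltry.
Qed.

(** Simple functions below [u] in absolute value obey the bound uniformly; their means
    converge by dominated convergence, and Fatou's lemma passes to the limit. *)
Lemma deviation_L2 (u : T -> R) : measurable_fun setT u ->
  (\int[nu]_x (u x ^+ 2)%:E < +oo)%E ->
  (\int[nu]_x (deviation u (E u) x ^+ 2)%:E <=
   (kap ^+ 2)%:E * \int[nu]_x (u x ^+ 2)%:E)%E.
Proof.
move=> mu u2; have [phi [aphi phiu cphi]] := approximable_below (1%g :: D) mu.
have intu := L2_integrable mu u2.
have Ecv : E (phi k) @[k --> \oo] --> E u.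
  have [|||||_ _ h] := @dominated_convergence _ _ _ nu setT measurableT
    (fun k x => (phi k x)%:E) (fun x => (u x)%:E) (fun x => `|(u x)%:E|)%E.
  - by move=> k; apply/measurable_EFinP; exact: (aphi k).1.1.
  - exact/measurable_EFinP.
  - by apply: aeW => x _; apply/fine_cvgP; split; [exact: nearW | exact: cphi].
  - exact: integrable_abse.
  - by apply: aeW => x k _; rewrite lee_fin.
  have h' : (\int[nu]_x (phi k x)%:E)%E @[k --> \oo] --> (E u)%:E.
    by rewrite /mean /Rintegral fineK; [exact: h|exact: integrable_fin_num].
  exact: (fine_cvg h').
apply: (@fatou_le (fun k x => deviation (phi k) (E (phi k)) x ^+ 2)).
- by move=> k; have [] := bmX 2 (bm_deviation (E (phi k)) (aphi k).1).
- by move=> k x; exact: sqr_ge0.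
- move=> x.
  have h : deviation (phi k) (E (phi k)) x @[k --> \oo] --> deviation u (E u) x.
    rewrite /deviation; apply: (cvgB _ Ecv); apply: cvgMl_tmp.
    elim: D => [|g s IH].
      by under eq_fun do rewrite big_nil; rewrite big_nil; exact: cvg_cst.
    under eq_fun do rewrite big_cons; rewrite big_cons.
    exact: (cvgD (cphi _) IH).
  have h2 := cvgM h h.
  by under eq_fun do rewrite expr2; rewrite expr2; exact: h2.
move=> k; have bd := bmX 2 (bm_deviation (E (phi k)) (aphi k).1).
have bp := bmX 2 (aphi k).1.
have fin (f : T -> R) : bm f -> (\int[nu]_x (f x)%:E)%E = (E f)%:E.
  move=> bf; rewrite /mean /Rintegral fineK //.
  by apply: integrable_fin_num => //; exact: (bm_integrable nu bf).
rewrite fin //; apply: (@le_trans _ _ ((kap ^+ 2)%:E * (\int[nu]_x (phi k x ^+ 2)%:E))%E).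
  by rewrite fin // -EFinM lee_fin deviation_approximable.
apply: lee_wpmul2l; first by rewrite lee_fin sqr_ge0.
apply: ge0_le_integral => //.
- by move=> x _; rewrite lee_fin sqr_ge0.
- by apply/measurable_EFinP; case: bp.
- by apply/measurable_EFinP; exact: measurable_funX.
move=> x _; rewrite lee_fin -[leLHS]real_normK ?num_real // -[leRHS]real_normK ?num_real //.
by apply: exprn_mono.
Qed.
End Deviation.

(** * Complex functions and the supremum *)

Section SupDeviation.
Variable R : realType.
Local Notation T := (torus R).
Variable nu : probability T R.
Hypothesis haar : normalized_haar nu.
Implicit Types (f : T -> R[i]) (x : T).
Local Notation E := (mean nu).

Lemma complexReD (y z : R[i]) : complex.Re (y + z) = complex.Re y + complex.Re z.
Proof. by case: y z => [a b] [c e]. Qed.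

Lemma complexImD (y z : R[i]) : complex.Im (y + z) = complex.Im y + complex.Im z.
Proof. by case: y z => [a b] [c e]. Qed.

Lemma complexRe_sum (I : Type) (s : seq I) (F : I -> R[i]) :
  complex.Re (\sum_(i <- s) F i) = \sum_(i <- s) complex.Re (F i).
Proof. by apply: (big_morph _ complexReD). Qed.

Lemma complexIm_sum (I : Type) (s : seq I) (F : I -> R[i]) :
  complex.Im (\sum_(i <- s) F i) = \sum_(i <- s) complex.Im (F i).
Proof. by apply: (big_morph _ complexImD). Qed.

Lemma natr_invC n : (n%:R : R[i])^-1 = ((n%:R : R)^-1)%:C%C.
Proof. by rewrite fmorphV rmorph_nat. Qed.

Lemma complexReZ (r : R) (z : R[i]) : complex.Re (r%:C%C * z) = r * complex.Re z.
Proof. by case: z => a b /=; rewrite mul0r subr0. Qed.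

Lemma complexImZ (r : R) (z : R[i]) : complex.Im (r%:C%C * z) = r * complex.Im z.
Proof. by case: z => a b /=; rewrite mul0r addr0. Qed.

Definition sqmod f x : R := complex.Re (f x) ^+ 2 + complex.Im (f x) ^+ 2.

Lemma sqmod_ge0 f x : 0 <= sqmod f x.
Proof. by rewrite addr_ge0 // sqr_ge0. Qed.

Lemma normc_sqmod f x : (`|(Normc.normc (f x))%:E| `^ 2 = (sqmod f x)%:E)%E.
Proof.
rewrite /sqmod /Normc.normc; case: (f x) => a b /=.
rewrite ger0_norm ?sqrtr_ge0 // powR_mulrn ?sqrtr_ge0 // sqr_sqrtr //.
by rewrite addr_ge0 // sqr_ge0.
Qed.

Lemma L2normE f : L2norm nu f = ((\int[nu]_x (sqmod f x)%:E) `^ 2^-1)%E.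
Proof.
rewrite /L2norm unlock; congr (_ `^ _)%E.
by apply: eq_integral => x _; exact: normc_sqmod.
Qed.

Lemma L2norm_eq1 f : L2norm nu f = 1%E -> (\int[nu]_x (sqmod f x)%:E = 1)%E.
Proof.
move=> f1; have : (L2norm nu f `^ 2 = \int[nu]_x (`|(Normc.normc (f x))%:E| `^ 2))%E.
  by rewrite /L2norm poweR_Lnorm.
rewrite f1 poweR1r => ->; apply: eq_integral => x _.
by rewrite normc_sqmod.
Qed.

Lemma L2norm_le f (k : R) : 0 <= k -> (\int[nu]_x (sqmod f x)%:E <= (k ^+ 2)%:E)%E ->
  (L2norm nu f <= k%:E)%E.
Proof.
move=> k0 h; rewrite L2normE.
have -> : k%:E = ((k ^+ 2)%:E `^ 2^-1)%E.
  by rewrite poweR_EFin powR12_sqrt ?sqr_ge0 // sqrtr_sqr ger0_norm.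
have i0 : (0 <= \int[nu]_x (sqmod f x)%:E)%E.
  by apply: integral_ge0 => x _; rewrite lee_fin sqmod_ge0.
apply: gt0_ler_poweR => //; rewrite in_itv /= ?i0 ?leey //.
by rewrite lee_fin sqr_ge0.
Qed.

Lemma L2norm_real (u : T -> R) : bounded_measurable u ->
  L2norm nu (fun x => (u x)%:C%C) = (l2 nu u)%:E.
Proof.
move=> bu; rewrite L2normE.
have -> : (\int[nu]_x (sqmod (fun x => (u x)%:C%C) x)%:E)%E = (E (fun x => u x ^+ 2))%:E.
  rewrite /mean /Rintegral fineK.
    by apply: eq_integral => x _; rewrite /sqmod /= expr0n addr0.
  by apply: integrable_fin_num => //; exact: (bm_integrable nu (bmX 2 bu)).
by rewrite poweR_EFin powR12_sqrt // mean_sqr_ge0.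
Qed.

Variable A : set GL2Z.
Hypothesis finA : finite_set A.
Let D : seq GL2Z := fset_set A.

Lemma average_Re f x : complex.Re (average A f x - cintegral nu f) =
  deviation D (fun x => complex.Re (f x)) (E (fun x => complex.Re (f x))) x.
Proof.
rewrite /average fsbig_finite //= complexReD natr_invC complexReZ complexRe_sum.
by rewrite /deviation cardfE.
Qed.

Lemma average_Im f x : complex.Im (average A f x - cintegral nu f) =
  deviation D (fun x => complex.Im (f x)) (E (fun x => complex.Im (f x))) x.
Proof.
rewrite /average fsbig_finite //= complexImD natr_invC complexImZ complexIm_sum.
by rewrite /deviation cardfE.
Qed.

Variable kap : R.
Hypothesis kap0 : 0 < kap.
Hypothesis D0 : (0 < size D)%N.
Local Notation S := ((size D)%:R : R).
Hypothesis trig_bound : forall p,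
  E (fun x => deviation D (trig p) (E (trig p)) x ^+ 2) <=
  kap ^+ 2 * E (fun x => trig p x ^+ 2).
Hypothesis trig_sharp : forall M : R, 0 <= M ->
  (forall p, (forall c, c \in p -> c.1.2 != 0) ->
    E (fun x => walk_sum D p 1 x ^+ 2) <= M * E (fun x => trig p x ^+ 2)) ->
  (S * kap) ^+ 2 <= M.

(** The squared modulus is additive in the real and imaginary parts, on which the
    deviation acts separately. *)
Lemma sup_deviation_le : (sup_deviation nu A <= kap%:E)%E.
Proof.
apply: ge_ereal_sup => _ [f [[[mRe mIm] _] f1] <-].
apply: L2norm_le; first exact: ltW.
set u := fun x => complex.Re (f x) in mRe *; set v := fun x => complex.Im (f x) in mIm *.
have mu2 : measurable_fun setT (fun x => (u x ^+ 2)%:E).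
  by apply/measurable_EFinP; exact: measurable_funX.
have mv2 : measurable_fun setT (fun x => (v x ^+ 2)%:E).
  by apply/measurable_EFinP; exact: measurable_funX.
have iu0 : (0 <= \int[nu]_x (u x ^+ 2)%:E)%E.
  by apply: integral_ge0 => x _; rewrite lee_fin sqr_ge0.
have iv0 : (0 <= \int[nu]_x (v x ^+ 2)%:E)%E.
  by apply: integral_ge0 => x _; rewrite lee_fin sqr_ge0.
have sum1 : (\int[nu]_x (u x ^+ 2)%:E + \int[nu]_x (v x ^+ 2)%:E = 1)%E.
  rewrite -(L2norm_eq1 f1) -ge0_integralD //.
  - by move=> x _; rewrite lee_fin sqr_ge0.
  - by move=> x _; rewrite lee_fin sqr_ge0.
have u_fin : (\int[nu]_x (u x ^+ 2)%:E < +oo)%E.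
  by apply: (@le_lt_trans _ _ 1%E); [rewrite -sum1 leeDl|exact: ltry].
have v_fin : (\int[nu]_x (v x ^+ 2)%:E < +oo)%E.
  by apply: (@le_lt_trans _ _ 1%E); [rewrite -sum1 leeDr|exact: ltry].
have du := deviation_L2 D0 (ltW kap0) trig_bound mRe u_fin.
have dv := deviation_L2 D0 (ltW kap0) trig_bound mIm v_fin.
have mdev (w : T -> R) m : measurable_fun setT w ->
    measurable_fun setT (fun x => (deviation D w m x ^+ 2)%:E).
  move=> mw; apply/measurable_EFinP; apply: measurable_funX.
  apply: measurable_funB => //; apply: measurable_funM => //.
  apply: measurable_sum => g; apply: measurableT_comp => //.
  exact: torus_act_measurable.
have -> : (\int[nu]_x (sqmod (fun x => average A f x - cintegral nu f) x)%:E =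
   \int[nu]_x (deviation D u (E u) x ^+ 2)%:E +
   \int[nu]_x (deviation D v (E v) x ^+ 2)%:E)%E.
  rewrite -ge0_integralD //.
  - by apply: eq_integral => x _; rewrite /sqmod average_Re average_Im -EFinD.
  - by move=> x _; rewrite lee_fin sqr_ge0.
  - exact: mdev.
  - by move=> x _; rewrite lee_fin sqr_ge0.
  - exact: mdev.
apply: le_trans (leeD du dv) _.
by rewrite -ge0_muleDr // sum1 mule1.
Qed.

(** By homogeneity, a smaller supremum [M] would bound the operator by [M] on all
    trigonometric polynomials of mean zero, against [trig_sharp]. *)
Lemma sup_deviation_ge : (kap%:E <= sup_deviation nu A)%E.
Proof.
rewrite leNgt; apply/negP => lt.
have S0 : 0 < S by rewrite ltr0n.
pose M := Num.max (fine (sup_deviation nu A)) 0.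
have M0 : 0 <= M by rewrite le_max lexx orbT.
have [supM Mk] : (sup_deviation nu A <= M%:E)%E /\ M < kap.
  rewrite /M; move: lt; case: (sup_deviation nu A) => [s|//|] /=.
    by rewrite lte_fin lee_fin gt_max kap0 le_max lexx => ->.
  by rewrite maxxx kap0 leNye.
suff H p : (forall c, c \in p -> c.1.2 != 0) ->
    E (fun x => walk_sum D p 1 x ^+ 2) <= (S * M) ^+ 2 * E (fun x => trig p x ^+ 2).
  have := trig_sharp (sqr_ge0 _) H.
  rewrite ler_sqr ?nnegrE ?mulr_ge0 //; last exact: ltW.
  by rewrite ler_pM2l // leNgt Mk.
move=> p0; have bp := bm_trig p.
have mp : E (trig p) = 0.
  by rewrite mean_trig // big_seq_cond big1 // => e /andP[/p0 /negPf ->].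
have devE x : deviation D (trig p) 0 x = S^-1 * walk_sum D p 1 x.
  by rewrite /deviation subr0 walk_sumS; congr (_ * _); apply: eq_bigr => g _; rewrite walk_sum0.
have bW := bm_walk_sum D p 1.
suff main : l2 nu (deviation D (trig p) 0) <= M * l2 nu (trig p).
  have -> : (fun x => walk_sum D p 1 x ^+ 2) = (fun x => S ^+ 2 * deviation D (trig p) 0 x ^+ 2).
    by apply/funext => x; rewrite devE -exprMn mulVKf // gt_eqF.
  rewrite meanZ; last by apply: bmX; exact: bm_deviation.
  rewrite [(S * M) ^+ 2]exprMn -[leRHS]mulrA ler_wpM2l ?sqr_ge0 // -!l2_sqr -exprMn.
  by apply: exprn_mono => //; exact: l2_ge0.
have [z|nz] := eqVneq (l2 nu (trig p)) 0.
  rewrite z mulr0; apply: l2_le => //.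
  have h := trig_bound p; rewrite mp in h; apply: le_trans h _.
  by rewrite -l2_sqr z expr0n mulr0.
have np : 0 < l2 nu (trig p) by rewrite lt_neqAle eq_sym nz l2_ge0.
set c := l2 nu (trig p) in nz np *.
pose u x := c^-1 * trig p x.
have bu : bounded_measurable u by exact: bmZ.
have l2Z (k : R) (w : T -> R) : 0 <= k -> bounded_measurable w ->
    l2 nu (fun x => k * w x) = k * l2 nu w.
  move=> k0 bw; rewrite /l2; under [in LHS]eq_fun do rewrite exprMn.
  rewrite meanZ; last exact: bmX.
  by rewrite sqrtrM ?sqr_ge0 // sqrtr_sqr ger0_norm.
have ic0 : 0 <= c^-1 by rewrite invr_ge0 ltW.
have u1 : l2 nu u = 1 by rewrite l2Z // -/c mulVf.
pose f x : R[i] := (u x)%:C%C.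
have fL2 : L2norm nu f = 1%E by rewrite L2norm_real // u1.
have : (L2norm nu (fun x => average A f x - cintegral nu f)%R <= M%:E)%E.
  apply: le_trans supM; apply: ereal_sup_ubound; exists f => //.
  split=> //; split; last by rewrite fL2 ltry.
  by split; [exact: bu.1|exact: measurable_cst].
have Eu : E u = 0 by rewrite /u meanZ // mp mulr0.
have -> : (fun x => average A f x - cintegral nu f) =
    (fun x => (c^-1 * deviation D (trig p) 0 x)%:C%C).
  apply/funext => x; apply/eqP; rewrite eq_complex average_Re average_Im.
  have -> : deviation D (fun x => complex.Im (f x)) (E (fun x => complex.Im (f x))) x = 0.
    by rewrite /f /= mean_cst /deviation subr0 big1 ?mulr0.
  rewrite eqxx andbT /f /= -/u Eu /deviation !subr0.
  by rewrite /u -mulr_sumr mulrCA.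
rewrite L2norm_real; last by apply: bmZ; exact: bm_deviation.
rewrite l2Z //; last exact: bm_deviation.
by rewrite lee_fin ler_pdivrMl // mulrC.
Qed.

Theorem sup_deviationE : sup_deviation nu A = kap%:E.
Proof. by apply/eqP; rewrite eq_le sup_deviation_le sup_deviation_ge. Qed.
End SupDeviation.

(** * Spheres and balls *)

Section WordSets.
Variables (R : realType) (nu : probability (torus R) R).
Hypothesis haar : normalized_haar nu.
Variables (r : nat) (a : 'I_r -> GL2Z).
Hypotheses (r0 : (0 < r)%N) (free : free_words a).
Variable s : R.
Hypotheses (s0 : 0 < s) (sE : s ^+ 2 = 2 * r%:R - 1).
Local Notation L := ('I_r * bool)%type.
Variables (A : set GL2Z) (n : nat) (ws : seq (seq L)).
Hypotheses (ws_uniq : uniq ws) (ws0 : (0 < size ws)%N).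
Hypothesis ws_red : forall w, w \in ws -> reduced w && (size w <= n)%N.
Hypothesis ws_inv : forall w, w \in ws -> winv w \in ws.
Hypothesis AE : A = [set ev a w | w in [set` ws]].
Variable Lam : R.
Hypothesis Lam0 : 0 < Lam.
Local Notation phi := (spherical a s).
Hypothesis ws_eigen : forall g,
  \sum_(w <- ws) phi (ev a w * g)%g = Lam * phi g.

Lemma AE_seq : A = [set` [seq ev a w | w <- ws]].
Proof.
rewrite AE; apply/seteqP; split => g /=.
  by move=> [w ww <-]; exact: map_f.
by move=> /mapP[w ww ->]; exists w.
Qed.

Lemma finite_words : finite_set A.
Proof. rewrite AE_seq; exact: finite_seq. Qed.

Let D : seq GL2Z := fset_set A.

Lemma perm_words : perm_eq D [seq ev a w | w <- ws].
Proof.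
apply: uniq_perm.
- exact: fset_uniq.
- rewrite map_inj_in_uniq // => w u /ws_red /andP[rw _] /ws_red /andP[ru _].
  exact: ev_inj.
by move=> g; rewrite /D in_fset_set ?AE_seq //; [apply/idP/idP; rewrite inE|exact: finite_seq].
Qed.

Lemma size_words : size D = size ws.
Proof. by rewrite (perm_size perm_words) size_map. Qed.

Lemma symmetric_words : symmetric_seq D.
Proof.
apply: uniq_perm.
- rewrite map_inj_uniq ?fset_uniq //; exact: invg_inj.
- exact: fset_uniq.
have inv g : g \in D -> (g^-1)%g \in D.
  rewrite !(perm_mem perm_words) => /mapP[w ww ->].
  by rewrite -ev_winv map_f // ws_inv.
move=> g; apply/mapP/idP => [[h hD ->]|gD]; first exact: inv.
by exists (g^-1)%g; [exact: inv|rewrite invgK].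
Qed.

Lemma words_eigen g : \sum_(d <- D) phi (d * g)%g = Lam * phi g.
Proof. by rewrite -ws_eigen (perm_big _ perm_words) big_map. Qed.

Lemma walks_words k g : g \in walks D k ->
  exists2 w, (size w <= k * n)%N & ev a w = g.
Proof.
elim: k g => [|k IH] g.
  by rewrite inE => /eqP ->; exists [::] => //; rewrite ev_nil.
move=> /allpairsP[[d h] /= [dD /IH[w wk <-] ->]].
move: dD; rewrite (perm_mem perm_words) => /mapP[u /ws_red /andP[_ un] ->].
by exists (u ++ w); [rewrite size_cat mulSn leq_add | rewrite ev_cat].
Qed.

Lemma words_growth k :
  \sum_(g <- undup (walks D k)) phi g ^+ 2 <= (2 * n.+1%:R ^+ 3) * k.+1%:R ^+ 3.
Proof.
apply: le_trans (spherical_l2 free s0 sE (n := (k * n)%N) r0 (undup_uniq _) _) _.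
  by move=> g; rewrite mem_undup; exact: walks_words.
rewrite -mulrA ler_wpM2l // -exprMn; apply: exprn_mono => //.
by rewrite -natrM ler_nat mulSn mulnS; lia.
Qed.

(** Spheres and balls differ only by the list of words, on which it is enough to know
    that [spherical] is an eigenfunction. *)
Theorem sup_deviation_words :
  sup_deviation nu A = (Lam / (size ws)%:R)%:E.
Proof.
have upper k : (count_mem 1%g (walks D k))%:R <= Lam ^+ k.
  apply: (@returns_le _ R D phi Lam) => //.
  - exact: spherical1.
  - by move=> g; exact: spherical_ge0.
  - exact: words_eigen.
have lower k : Lam ^+ (k + k) <=
    (count_mem 1%g (walks D (k + k)))%:R * ((2 * n.+1%:R ^+ 3) * k.+1%:R ^+ 3).
  apply: le_trans (returns_ge (spherical1 free s) words_eigen k symmetric_words) _.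
  by rewrite ler_wpM2l // words_growth.
have D0 : (0 < size D)%N by rewrite size_words.
have C0 : 0 <= 2 * n.+1%:R ^+ 3 :> R by rewrite mulr_ge0 // exprn_ge0.
have S0 : 0 < (size D)%:R :> R by rewrite ltr0n.
rewrite -size_words; apply: (sup_deviationE haar finite_words) => //.
- by rewrite divr_gt0.
- move=> p.
  have -> : (fun x => deviation D (trig p) (mean nu (trig p)) x ^+ 2) =
      (fun x => ((size D)%:R^-1 * walk_sum D p 1 x - mean nu (trig p)) ^+ 2).
    apply/funext => x; rewrite /deviation walk_sumS; congr ((_ * _ - _) ^+ 2).
    by apply: eq_bigr => g _; rewrite walk_sum0.
  exact: (trig_deviation haar symmetric_words (ltW Lam0) upper p D0).
move=> M M0 H; rewrite mulrC divfK ?gt_eqF //.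
exact: (trig_norm_ge haar symmetric_words C0 lower M0 H).
Qed.
End WordSets.

Section SphereAndBall.
Variables (R : realType) (r : nat).
Local Notation L := ('I_r * bool)%type.

Definition ball_words n : seq (seq L) :=
  [seq w | k <- iota 0 n.+1, w <- rwords r k].

Lemma mem_ball_words n w : (w \in ball_words n) = (size w <= n)%N && reduced w.
Proof.
apply/allpairsPdep/andP => [[k [u [kn uk ->]]]|[wn rw]].
  move: uk kn; rewrite mem_rwords mem_iota => /andP[/eqP <- ->].
  by rewrite add0n ltnS.
by exists (size w), w; rewrite mem_iota mem_rwords eqxx rw ltnS.
Qed.

Lemma ball_words_uniq n : uniq (ball_words n).
Proof.
apply: allpairs_uniq_dep => [|k _|].
- exact: iota_uniq.
- exact: rwords_uniq.
move=> [k w] [l u] /allpairsPdep[k' [w' [_ h ->]]] /allpairsPdep[l' [u' [_ h' ->]]] /=.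
move: h h'; rewrite !mem_rwords => /andP[/eqP <- _] /andP[/eqP <- _] ->.
by [].
Qed.

Variable s : R.
Hypotheses (s0 : 0 < s) (sE : s ^+ 2 = 2 * r%:R - 1).
Local Notation q := (s ^+ 2).

(** That is, [q ^+ n] divided by the constant [c] of the theorem. *)
Lemma size_ball_words n :
  (size (ball_words n))%:R = q ^+ n + 2 * \sum_(0 <= k < n) q ^+ k :> R.
Proof.
have -> : (size (ball_words n))%:R = \sum_(0 <= k < n.+1) sphere_card R r k.
  by rewrite /ball_words -sum1_size natr_sum big_allpairs_dep;
     apply: eq_bigr => k _; rewrite /sphere_card -sum1_size natr_sum.
elim: n => [|n IH].
  by rewrite big_nat1 big_nil mulr0 addr0 /sphere_card.
rewrite big_nat_recr //= IH big_nat_recr //= (sphere_cardE sE) !exprS; ring.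
Qed.

Lemma sphere_psi_sum n :
  \sum_(0 <= k < n.+1) sphere_card R r k * psi s k =
  s ^+ n * (1 + (1 + s^-1) * n%:R).
Proof.
elim: n => [|n IH].
  by rewrite big_nat1 psi0 /sphere_card mulr0 addr0 expr0.
rewrite big_nat_recr //= IH (sphere_cardE sE) /psi.
have -> : (s ^+ 2) ^+ n = s ^+ n * s ^+ n by rewrite -exprM mul2n -addnn exprD.
rewrite [s ^+ n.+1]exprS -[n.+1%:R]natr1.
have sn : s ^+ n != 0 by rewrite expf_neq0 // gt_eqF.
have sn0 : s != 0 by rewrite gt_eqF.
have q1 := q1_neq0 s.
move: (s ^+ n) (n%:R) sn => X N X0; field.
by rewrite X0 sn0 q1.
Qed.
End SphereAndBall.

Theorem theorem1p5 (R : realType) (nu : probability (torus R) R)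
    (r : nat) (Gamma : set GL2Z) (a : 'I_r -> GL2Z) (n : nat) :
  normalized_haar nu ->
  (1 <= r)%N ->
  freely_generated Gamma a ->
  let gens := symmetric_generators a in
  let q : R := 2 * r%:R - 1 in
  let c : R := (1 + 2 * q ^- n * \sum_(0 <= k < n) q ^+ k)^-1 in
  sup_deviation nu (sphere Gamma gens n) =
    ((1 + (q - 1) / (q + 1) * n%:R) * q `^ (- (n%:R / 2)))%:E
  /\
  sup_deviation nu (word_ball Gamma gens n) =
    (c * (1 + (1 + 1 / Num.sqrt q) * n%:R) * q `^ (- (n%:R / 2)))%:E.
Proof.
move=> haar r0 [-> free] gens q c.
have r1 : 1 <= r%:R :> R by rewrite ler1n.
have q0 : 0 < q by rewrite /q; lra.
pose s := Num.sqrt q; have s0 : 0 < s by rewrite sqrtr_gt0.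
have sE : s ^+ 2 = q by rewrite sqr_sqrtr // ltW.
have powE : q `^ (- (n%:R / 2)) = s ^- n.
  by rewrite powRN mulrC powRrM powR12_sqrt ?ltW // powR_mulrn ?ltW.
have freew : free_words a by [].
have card_gt0 k : 0 < sphere_card R r k.
  rewrite (sphere_cardE sE); case: k => [|k] //.
  by rewrite mulr_gt0 ?exprn_gt0 // ltr_wpDl // sqr_ge0.
have psi_pos k : 0 < psi s k by exact: (psi_gt0 s0 sE).
split.
  have -> : sphere (generated_subgroup (range a)) gens n =
      [set ev a w | w in [set` rwords r n]].
    apply/seteqP; split => g /=.
      move=> [_ /(has_word_lengthP g n freew)[w [rw wn <-]]].
      by exists w => //=; rewrite mem_rwords wn eqxx.
    move=> [w /=]; rewrite mem_rwords => /andP[/eqP wn rw] <-; split.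
      exact: ev_generated.
    by apply/(has_word_lengthP _ n freew); exists w.
  rewrite (@sup_deviation_words R nu haar r a r0 freew s s0 sE _ n (rwords r n)
    _ _ _ _ erefl (sphere_card R r n * psi s n)).
  - congr (_%:E); rewrite -/(sphere_card R r n) mulrAC divff ?mul1r ?gt_eqF //.
    by rewrite powE /psi sE.
  - exact: rwords_uniq.
  - by have := card_gt0 n; rewrite /sphere_card ltr0n.
  - by move=> w; rewrite mem_rwords => /andP[/eqP -> ->] /=.
  - by move=> w; rewrite !mem_rwords reduced_winv /winv size_rev size_map.
  - by rewrite mulr_gt0.
  - by move=> g; exact: spherical_sphere.
have -> : word_ball (generated_subgroup (range a)) gens n =
    [set ev a w | w in [set` ball_words r n]].
  apply/seteqP; split => g /=.
    move=> [_ [k kn /(has_word_lengthP g k freew)[w [rw wk <-]]]].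
    by exists w => //=; rewrite mem_ball_words wk kn.
  move=> [w /=]; rewrite mem_ball_words => /andP[wn rw] <-; split.
    exact: ev_generated.
  by exists (size w) => //; apply/(has_word_lengthP _ _ freew); exists w.
rewrite (@sup_deviation_words R nu haar r a r0 freew s s0 sE _ n (ball_words r n)
    _ _ _ _ erefl (\sum_(0 <= k < n.+1) sphere_card R r k * psi s k)).
- congr (_%:E); rewrite (size_ball_words sE) (sphere_psi_sum s0 sE) powE sE /c.
  have qn : q ^+ n = s ^+ n * s ^+ n by rewrite -sE -exprM mul2n -addnn exprD.
  have Q0 : 0 <= \sum_(0 <= k < n) q ^+ k.
    by apply: sumr_ge0 => k _; rewrite exprn_ge0 // ltW.
  rewrite qn -/s; move: (\sum_(0 <= k < n) q ^+ k) Q0 => Q Q0.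
  have X0 : 0 < s ^+ n by rewrite exprn_gt0.
  move: (s ^+ n) X0 => X X0.
  have XQ : 0 < X * X + 2 * Q by rewrite ltr_wpDr ?mulr_gt0 // mulr_ge0.
  by field; rewrite !gt_eqF.
- exact: ball_words_uniq.
- by rewrite lt0n size_eq0; apply/eqP => e; have := mem_ball_words n ([::] : seq ('I_r * bool)); rewrite e.
- by move=> w; rewrite mem_ball_words andbC.
- by move=> w; rewrite !mem_ball_words reduced_winv /winv size_rev size_map.
- rewrite big_nat_recl //=.
  have tail0 : 0 <= \sum_(0 <= k < n) sphere_card R r k.+1 * psi s k.+1.
    by apply: sumr_ge0 => k _; rewrite mulr_ge0 // ltW.
  by apply: ltr_pwDl tail0; rewrite mulr_gt0.
move=> g; rewrite big_allpairs_dep mulr_suml; apply: eq_bigr => k _.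
exact: spherical_sphere.
Qed.
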